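(* Consider the linear map $$\rho:\mathcal{H}_{\mathbf{QP}}\to\mathcal{H}_{\mathbf{QP}}\otimes\mathcal{H}_{\mathbf{qp}},\qquad P\mapsto\sum_{\sim\triangleleft P}(P/\sim)\otimes\lfloor P|\sim\rfloor\quad(P\in\mathbf{QP}).$$ The bialgebras $(\mathcal{H}_{\mathbf{QP}},m,\Delta)$ and $(\mathcal{H}_{\mathbf{qp}},m,\delta)$ are in cointeraction via $\rho$.
   Context: $\mathbb{K}$ is a field of characteristic zero, $[n]=\{1,\ldots,n\}$. A quasi-poset is a pair $P=(A,\leq_P)$ with $A$ finite and $\leq_P$ reflexive and transitive; $x\sim_Py$ means $x\leq_Py$ and $y\leq_Px$; $\lfloor P\rfloor$ is the isoclass; $P_{\mid B}$ is the restriction to $B\subseteq A$; $top(P)$ is the topology of open sets, i.e. subsets $O$ with ($i\in O$, $i\leq_Pj$)$\Rightarrow j\in O$; $P$ is connected if this topology is connected. $P$ is discrete if $\leq_P$ equals $\sim_P$. For an equivalence $\sim$ on $A$: $x\leq_{P|\sim}y$ iff $x\leq_Py$ and $x\sim y$; $\leq_{P/\sim}$ is the transitive closure of the relation ($x\leq_Py$ or $x\sim y$); these give quasi-posets $P|\sim$ and $P/\sim$ on $A$. We write $\sim\triangleleft P$ if the restriction of $P$ to each class of $\sim$ is connected and $\sim_{P/\sim}$ equals $\sim$. $\mathbf{QP}(n)$ is the set of quasi-posets on $[n]$, $\mathbf{QP}=\bigsqcup_{n\ge0}\mathbf{QP}(n)$; $\mathbf{qp}$ is the set of isoclasses of quasi-posets;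 $\mathcal{H}_{\mathbf{QP}}$, $\mathcal{H}_{\mathbf{qp}}$ are the $\mathbb{K}$-vector spaces with these bases. For a quasi-poset on a subset of $\mathbb{N}$ with $n$ elements, $Std$ denotes its transport to $[n]$ by the increasing bijection. $(\mathcal{H}_{\mathbf{QP}},m,\Delta)$ is the bialgebra with $PQ$ (for $P\in\mathbf{QP}(k)$, $Q\in\mathbf{QP}(l)$) the disjoint union of $P$ on $[k]$ and $Q$ shifted by $k$ on $\{k+1,\ldots,k+l\}$, and $\Delta(P)=\sum_{O\in top(P)}Std(P_{\mid[n]\setminus O})\otimes Std(P_{\mid O})$ for $P\in\mathbf{QP}(n)$; its counit is $1$ on the empty quasi-poset $1$ (the unit) and $0$ on other quasi-posets. $(\mathcal{H}_{\mathbf{qp}},m,\delta)$ is the bialgebra with product disjoint union, coproduct $\delta(\lfloor P\rfloor)=\sum_{\sim\triangleleft P}\lfloor P/\sim\rfloor\otimes\lfloor P|\sim\rfloor$, and counit $\varepsilon'(\lfloor P\rfloor)=1$ if $P$ is discrete, $0$ otherwise. Cointeraction: two bialgebras $A$ and $B$ are in cointeraction via $\rho:A\to A\otimes B$ if $\rho$ is a right coaction of $B$ on $A$ (i.e. $(\rho\otimes Id)\circ\rho=(Id\otimes\Delta_B)\circ\rho$ and $(Id\otimes\varepsilon_B)\circ\rho=Id$) and: (i) $\rho(1_A)=1_A\otimes1_B$; (ii) $m^3_{2,4}\circ(\rho\otimes\rho)\circ\Delta_A=(\Delta_A\otimes Id)\circ\rho$, where $m^3_{2,4}(a_1\otimes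 b_1\otimes a_2\otimes b_2)=a_1\otimes a_2\otimes b_1b_2$; (iii) $\rho(ab)=\rho(a)\rho(b)$ for all $a,b\in A$; (iv) $(\varepsilon_A\otimes Id)\circ\rho(a)=\varepsilon_A(a)1_B$ for all $a\in A$. *)

(* Defs.v *)
From HB Require Import structures.
From mathcomp Require Import all_boot all_order all_algebra.
From mathcomp Require Import generic_quotient finmap zify.
From mathcomp.multinomials Require Import monalg.

Set Implicit Arguments.
Unset Strict Implicit.
Unset Printing Implicit Defensive.

Import GRing.Theory.
Local Open Scope ring_scope.
Local Open Scope quotient_scope.

Section QOrder.
Variable T : finType.

Definition is_qorder (r : {ffun T -> {ffun T -> bool}}) : bool :=
  [forall x, r x x]
  && [forall x, forall y, forall z, r x y && r y z ==> r x z].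

Record qorder : predArgType := QOrder {
  qorder_val : {ffun T -> {ffun T -> bool}};
  qorder_valP : is_qorder qorder_val }.

HB.instance Definition _ := [isSub for qorder_val].
HB.instance Definition _ := [Finite of qorder by <:].

Definition qle (P : qorder) : rel T := fun x y => qorder_val P x y.
Coercion qle : qorder >-> rel.

Lemma qle_refl (P : qorder) : reflexive P.
Proof. by move=> x; have /andP[/forallP/(_ x)] := qorder_valP P. Qed.

Lemma qle_trans (P : qorder) : transitive P.
Proof.
move=> y x z rxy ryz; have /andP[_ /forallP tr] := qorder_valP P.
by apply: (implyP (forallP (forallP (tr x) y) z)); apply/andP.
Qed.

Lemma qorderP (P Q : qorder) : (forall x y, P x y = Q x y) <-> P = Q.
Proof.
split=> [eqPQ|-> //]; apply: val_inj; apply/ffunP=> x; apply/ffunP=> y.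
exact: eqPQ.
Qed.

Fact mk_qorder_subproof (r : rel T) : reflexive r -> transitive r ->
  is_qorder [ffun x => [ffun y => r x y]].
Proof.
move=> rr rt; apply/andP; split; first by apply/forallP=> x; rewrite !ffunE.
apply/forallP=> x; apply/forallP=> y; apply/forallP=> z; rewrite !ffunE.
by apply/implyP=> /andP[xy yz]; apply: rt xy yz.
Qed.

Definition mk_qorder (r : rel T) (rr : reflexive r) (rt : transitive r) :=
  QOrder (mk_qorder_subproof rr rt).

Lemma mk_qorderE (r : rel T) (rr : reflexive r) (rt : transitive r) x y :
  mk_qorder rr rt x y = r x y.
Proof. by rewrite /qle /= !ffunE. Qed.

Definition qsim (P : qorder) : rel T := fun x y => P x y && P y x.

Definition qdiscrete (P : qorder) : bool :=
  [forall x, forall y, P x y == qsim P x y].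

Definition qtop (P : qorder) : {set {set T}} :=
  [set O : {set T} | [forall i in O, forall j, P i j ==> (j \in O)]].

(* With this convention the empty space is connected; connectedness is only
   tested on equivalence classes, which are not empty. *)
Definition qconnected (P : qorder) : bool :=
  [forall O in qtop P, (~: O \in qtop P) ==> (O == set0) || (O == setT)].

Definition eqv : predArgType :=
  {e : qorder | [forall x, forall y, e x y ==> e y x]}.
HB.instance Definition _ := Finite.on eqv.
Definition qorder_of_eqv (e : eqv) : qorder := val e.
Coercion qorder_of_eqv : eqv >-> qorder.

Lemma eqv_sym (e : eqv) : symmetric e.
Proof.
case: e => e es; rewrite /qorder_of_eqv /= => x y.
have s a b := implyP (forallP (forallP es a) b).
by apply/idP/idP; apply: s.
Qed.

Definition eclass (e : eqv) (x : T) : {set T} := [set y | e x y].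

Section Contraction.
Variables (P : qorder) (e : eqv).

Definition qcut_rel : rel T := fun x y => P x y && e x y.
Fact qcut_refl : reflexive qcut_rel.
Proof. by move=> x; rewrite /qcut_rel !qle_refl. Qed.
Fact qcut_trans : transitive qcut_rel.
Proof.
move=> y x z /andP[p1 e1] /andP[p2 e2].
by apply/andP; split; [apply: qle_trans p1 p2 | apply: qle_trans e1 e2].
Qed.
Definition qcut : qorder := mk_qorder qcut_refl qcut_trans.

(* [connect] is the reflexive transitive closure; the relation it is applied
   to is already reflexive. *)
Definition qquot : qorder :=
  mk_qorder (@connect0 T (fun x y => P x y || e x y))
            (@connect_trans T (fun x y => P x y || e x y)).
End Contraction.
End QOrder.

Section Pull.
Variables (T U : finType) (f : U -> T).

Definition qpull (P : qorder T) : qorder U :=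
  @mk_qorder U (fun x y => P (f x) (f y))
    (fun x => qle_refl P (f x)) (fun y x z => @qle_trans T P (f y) (f x) (f z)).

Lemma qpullE P x y : qpull P x y = P (f x) (f y).
Proof. exact: mk_qorderE. Qed.

Fact eqv_pull_subproof (e : eqv T) :
  [forall x, forall y, qpull e x y ==> qpull e y x].
Proof.
by apply/forallP=> x; apply/forallP=> y; rewrite !qpullE eqv_sym implybb.
Qed.
Definition eqv_pull (e : eqv T) : eqv U :=
  exist (fun q : qorder U => [forall x, forall y, q x y ==> q y x])
    (qpull e) (eqv_pull_subproof e).
Lemma eqv_pullE e x y : eqv_pull e x y = e (f x) (f y).
Proof. exact: qpullE. Qed.
End Pull.

Definition qrestr (T : finType) (P : qorder T) (B : {set T}) :
  qorder {x : T | x \in B} := qpull val P.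

(* The relation written [e \triangleleft P]. *)
Definition admissible (T : finType) (P : qorder T) (e : eqv T) : bool :=
  [forall x, qconnected (qrestr P (eclass e x))]
  && [forall x, forall y, qsim (qquot P e) x y == e x y].

Section Sum.
Variables (T U : finType) (P : qorder T) (Q : qorder U).
Definition qsum_rel : rel (T + U) := fun x y =>
  match x, y with
  | inl x, inl y => P x y
  | inr x, inr y => Q x y
  | _, _ => false
  end.
Fact qsum_refl : reflexive qsum_rel.
Proof. by case=> x /=; apply: qle_refl. Qed.
Fact qsum_trans : transitive qsum_rel.
Proof. by case=> y [] x [] z //=; apply: qle_trans. Qed.
Definition qsum : qorder (T + U)%type := mk_qorder qsum_refl qsum_trans.
End Sum.

Section Iso.
Definition qiso (T U : finType) (P : qorder T) (Q : qorder U) : bool :=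
  [exists f : {ffun T -> U}, exists g : {ffun U -> T},
    [&& [forall x, g (f x) == x], [forall y, f (g y) == y]
      & [forall x, forall y, P x y == Q (f x) (f y)]]].

Lemma qisoP (T U : finType) (P : qorder T) (Q : qorder U) :
  reflect (exists2 f : T -> U, bijective f
                      & forall x y, P x y = Q (f x) (f y)) (qiso P Q).
Proof.
apply: (iffP existsP) => [[f /existsP[g /and3P[fg gf PQ]]]|[f [g fg gf] PQ]].
  exists f; last by move=> x y; apply/eqP/(forallP (forallP PQ x)).
  by exists g => x; apply/eqP; [apply: (forallP fg)|apply: (forallP gf)].
exists [ffun x => f x]; apply/existsP; exists [ffun x => g x].
apply/and3P; split.
- by apply/forallP=> x; rewrite !ffunE fg.
- by apply/forallP=> x; rewrite !ffunE gf.
by apply/forallP=> x; apply/forallP=> y; rewrite !ffunE PQ.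
Qed.

Lemma qiso_refl (T : finType) (P : qorder T) : qiso P P.
Proof. by apply/qisoP; exists id => //; exists id. Qed.

Lemma qiso_sym_imp (T U : finType) (P : qorder T) (Q : qorder U) :
  qiso P Q -> qiso Q P.
Proof.
case/qisoP=> f [g fg gf] PQ; apply/qisoP; exists g; first by exists f.
by move=> x y; rewrite PQ !gf.
Qed.

Lemma qiso_trans (T U V : finType) (P : qorder T) (Q : qorder U)
  (S : qorder V) : qiso P Q -> qiso Q S -> qiso P S.
Proof.
case/qisoP=> f bf PQ /qisoP[g bg QS]; apply/qisoP.
by exists (g \o f); [apply: bij_comp | move=> x y; rewrite PQ QS].
Qed.

Lemma qiso_pull (T U : finType) (f : U -> T) (P : qorder T) :
  bijective f -> qiso (qpull f P) P.
Proof. by move=> bf; apply/qisoP; exists f => // x y; rewrite qpullE. Qed.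

Lemma qsum_iso (T T' U U' : finType) (P : qorder T) (P' : qorder T')
  (Q : qorder U) (Q' : qorder U') :
  qiso P P' -> qiso Q Q' -> qiso (qsum P Q) (qsum P' Q').
Proof.
case/qisoP=> f [f' ff' f'f] PP' /qisoP[g [g' gg' g'g] qrestr']; apply/qisoP.
exists (fun x => match x with inl x => inl (f x) | inr x => inr (g x) end).
  exists (fun x => match x with inl x => inl (f' x) | inr x => inr (g' x) end).
    by case=> x; rewrite ?ff' ?gg'.
  by case=> x; rewrite ?f'f ?g'g.
by case=> x [] y; rewrite !mk_qorderE /=.
Qed.

Lemma qconnected_iso (T U : finType) (P : qorder T) (Q : qorder U) :
  qiso P Q -> qconnected P = qconnected Q.
Proof.
suff imp (T' U' : finType) (P' : qorder T') (Q' : qorder U') :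
    qiso P' Q' -> qconnected P' -> qconnected Q'.
  by move=> h; apply/idP/idP; apply: imp => //; apply: qiso_sym_imp.
case/qisoP=> f [g fg gf] PQ /forall_inP cP.
have top (O : {set U'}) : O \in qtop Q' -> f @^-1: O \in qtop P'.
  rewrite !inE => /forall_inP oO; apply/forall_inP=> x; rewrite inE => fx.
  apply/forallP=> y; rewrite inE PQ.
  exact: (forallP (oO _ fx) (f y)).
apply/forall_inP=> O oO; apply/implyP=> oC.
have /implyP := cP _ (top _ oO).
rewrite -preimsetC => /(_ (top _ oC)) /orP[] /eqP /setP h; apply/orP.
  by left; apply/eqP/setP=> y; have := h (g y); rewrite !inE gf.
by right; apply/eqP/setP=> y; have := h (g y); rewrite !inE gf.
Qed.

Lemma connect_pull (T U : finType) (f : T -> U) (r : rel U) :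
  bijective f -> forall x y,
  connect (fun x y => r (f x) (f y)) x y = connect r (f x) (f y).
Proof.
case=> g fg gf x y; apply/idP/idP.
  case/connectP=> p; elim: p x => [|z p IH] x /= => [_ ->|]; first exact: connect0.
  by case/andP=> xz pz ey; apply: connect_trans (connect1 xz) (IH _ pz ey).
rewrite -{2}[x]fg -{2}[y]fg; move: (f x) (f y) => {x y}.
move=> x y /connectP[p]; elim: p x => [|z p IH] x /= => [_ ->|].
  exact: connect0.
case/andP=> xz pz ey; apply: connect_trans (IH _ pz ey).
by apply: connect1; rewrite !gf.
Qed.

Section Transport.
Variables (T U : finType) (f : T -> U) (P : qorder T) (Q : qorder U).
Hypothesis bf : bijective f.
Hypothesis PQ : forall x y, P x y = Q (f x) (f y).
Variable e : eqv U.

Lemma qquot_pull x y :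
  qquot P (eqv_pull f e) x y = qquot Q e (f x) (f y).
Proof.
rewrite !mk_qorderE -(connect_pull _ bf).
by apply: eq_connect=> a b; rewrite PQ eqv_pullE.
Qed.

Lemma qcut_pull x y :
  qcut P (eqv_pull f e) x y = qcut Q e (f x) (f y).
Proof. by rewrite !mk_qorderE /qcut_rel PQ eqv_pullE. Qed.

Lemma admissible_pull : admissible P (eqv_pull f e) = admissible Q e.
Proof.
have [g fg gf] := bf.
have cl x : qconnected (qrestr P (eclass (eqv_pull f e) x)) =
            qconnected (qrestr Q (eclass e (f x))).
  apply: qconnected_iso; apply/qisoP.
  have i1 (y : {y | y \in eclass (eqv_pull f e) x}) :
      f (val y) \in eclass e (f x).
    by case: y => y /=; rewrite !inE eqv_pullE.
  have i2 (y : {y | y \in eclass e (f x)}) :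
      g (val y) \in eclass (eqv_pull f e) x.
    by case: y => y /=; rewrite !inE eqv_pullE gf.
  exists (fun y => exist (fun y => y \in eclass e (f x)) _ (i1 y)).
    exists (fun y => exist (fun y => y \in eclass (eqv_pull f e) x) _ (i2 y)).
      by move=> y; apply: val_inj; rewrite /= fg.
    by move=> y; apply: val_inj; rewrite /= gf.
  by move=> y z; rewrite !qpullE /= PQ.
rewrite /admissible; congr andb.
  apply/forallP/forallP=> h x; last by rewrite cl.
  by have := h (g x); rewrite cl gf.
apply/forallP/forallP=> h x; apply/forallP=> y.
  have /forallP/(_ (g y)) := h (g x).
  by rewrite /qsim !qquot_pull eqv_pullE !gf.
by rewrite /qsim !qquot_pull eqv_pullE; apply: (forallP (h _)).
Qed.
End Transport.
End Iso.

Definition QP : predArgType := {n : nat & qorder 'I_n}.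
HB.instance Definition _ := Choice.copy QP {n : nat & qorder 'I_n}.

Definition mkQP (n : nat) (P : qorder 'I_n) : QP := Tagged (fun n => qorder 'I_n) P.

(* [natrel P] extends the relation of [P] to natural numbers, by [false]. *)
Definition natrel (P : QP) (i j : nat) : bool :=
  match (insub i : option 'I_(tag P)), (insub j : option 'I_(tag P)) with
  | Some i, Some j => tagged P i j
  | _, _ => false
  end.

Lemma natrel_ord (P : QP) (i j : 'I_(tag P)) : natrel P i j = tagged P i j.
Proof. by rewrite /natrel !valK. Qed.

Lemma natrel_out (P : QP) i j :
  ~~ ((i < tag P) && (j < tag P))%N -> natrel P i j = false.
Proof.
rewrite /natrel; case: insubP => [a -> _|//]; case: insubP => [b -> _|//].
by [].
Qed.

Lemma QPP (P Q : QP) :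
  tag P = tag Q -> (forall i j, natrel P i j = natrel Q i j) -> P = Q.
Proof.
case: P Q => [n P] [m Q] /= e; case: m / e Q => Q h.
congr Tagged; apply/qorderP=> i j.
by have := h i j; rewrite !natrel_ord.
Qed.

Definition QPone : QP := mkQP (@mk_qorder 'I_0 eq_op (@eqxx _) (@eq_op_trans _)).

Definition QPmul (P Q : QP) : QP :=
  mkQP (qpull (@split (tag P) (tag Q)) (qsum (tagged P) (tagged Q))).

Lemma natrel_mul (P Q : QP) i j : natrel (QPmul P Q) i j =
  natrel P i j
  || [&& tag P <= i, tag P <= j & natrel Q (i - tag P) (j - tag P)]%N.
Proof.
have [/andP[hi hj]|out] :=
    boolP ((i < tag P + tag Q) && (j < tag P + tag Q))%N; last first.
  rewrite natrel_out // natrel_out; last first.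
    by apply: contra out => /andP[a b]; rewrite !ltn_addr.
  have [/andP[Pi Pj]|] := boolP ((tag P <= i) && (tag P <= j))%N; last first.
    by rewrite andbA => /negbTE ->.
  rewrite natrel_out ?andbF //; apply: contra out; lia.
have -> : natrel (QPmul P Q) i j =
    tagged (QPmul P Q) (Ordinal hi) (Ordinal hj).
  by rewrite -natrel_ord.
rewrite qpullE mk_qorderE /=.
have o1 (a : 'I_(tag P)) : (tag P <= a)%N = false.
  by rewrite leqNgt ltn_ord.
have o2 (b : nat) : (tag P + b < tag P)%N = false.
  by rewrite ltnNge leq_addr.
case: splitP => a /= ea; case: splitP => b /= eb /=; rewrite ?ea ?eb.
- by rewrite natrel_ord o1 orbF.
- by rewrite natrel_out ?o1 // o2 andbF.
- by rewrite natrel_out ?o1 ?andbF // o2.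
- by rewrite !leq_addr !addKn natrel_ord natrel_out // o2.
Qed.

Lemma natrel_one i j : natrel QPone i j = false.
Proof. exact: natrel_out. Qed.

Lemma QP_size0 (P : QP) : tag P = 0%N -> P = QPone.
Proof. by move=> e; apply: QPP => // i j; rewrite !natrel_out ?e. Qed.

Fact QPmulA : associative QPmul.
Proof.
move=> P Q S; apply: QPP => [|i j]; first exact: addnA.
rewrite !natrel_mul /= !subnDA -orbA; congr orb.
have le k : (tag P + tag Q <= k)%N = (tag P <= k)%N && (tag Q <= k - tag P)%N.
  case: (leqP (tag P) k) => h; first by rewrite leq_subRL.
  by apply/negbTE; rewrite -ltnNge (leq_trans h) ?leq_addr.
by rewrite !le; do 2!case: (tag P <= _)%N => //=; rewrite andbF.
Qed.

Fact QPmul1 : right_id QPone QPmul.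
Proof.
move=> P; apply: QPP => [|i j]; first exact: addn0.
by rewrite natrel_mul natrel_one !andbF orbF.
Qed.

Fact QP1mul : left_id QPone QPmul.
Proof.
move=> P; apply: QPP => // i j.
by rewrite natrel_mul natrel_one /= !subn0.
Qed.

Fact QPunit P Q : QPmul P Q = QPone -> P = QPone /\ Q = QPone.
Proof.
move=> /(congr1 tag) /= /eqP; rewrite addn_eq0 => /andP[/eqP p /eqP q].
by split; apply: QP_size0.
Qed.

HB.instance Definition _ :=
  Choice_isMonomialDef.Build QP QPmulA QP1mul QPmul1 QPunit.

(** Standardisation of the restriction of [P] to [B]: the enumeration of a set
    of ordinals is increasing, see [enum_val_increasing]. *)
Definition QPstd (n : nat) (P : qorder 'I_n) (B : {set 'I_n}) : QP :=
  mkQP (qpull (fun i : 'I_#|B| => enum_val i) P).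

Lemma enum_val_increasing (n : nat) (B : {set 'I_n}) (i j : 'I_#|B|) :
  (enum_val i < enum_val j)%N = (i < j)%N.
Proof.
have s : sorted ltn (map val (enum B)).
  rewrite sorted_map {1}/enum_mem; apply: sorted_filter => [y x z|].
    exact: ltn_trans.
  by rewrite -enumT -sorted_map val_enum_ord iota_ltn_sorted.
have mono (a b : 'I_#|B|) : (a < b)%N -> (enum_val a < enum_val b)%N.
  move=> ab; have h (c : 'I_#|B|) : enum_val c = nth 0%N (map val (enum B)) c :> nat.
    by rewrite (nth_map (enum_default c)) // -cardE.
  rewrite !h; apply: (sorted_ltn_nth ltn_trans) => //;
    by rewrite inE size_map -cardE.
case: (ltngtP i j) => [/mono //|/mono|/val_inj ->]; last by rewrite ltnn.
by move=> h; apply/negbTE; rewrite -leqNgt ltnW.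
Qed.

Definition QPquot (P : QP) (e : eqv 'I_(tag P)) : QP := mkQP (qquot (tagged P) e).
Definition QPcut (P : QP) (e : eqv 'I_(tag P)) : QP := mkQP (qcut (tagged P) e).

Definition QPiso (P Q : QP) : bool := qiso (tagged P) (tagged Q).

Fact QPiso_equiv : equiv_class_of QPiso.
Proof.
split=> [P|P Q|P Q S]; first exact: qiso_refl.
  by apply/idP/idP; apply: qiso_sym_imp.
exact: qiso_trans.
Qed.

Canonical QPiso_equivRel := EquivRelPack QPiso_equiv.

Definition qp : predArgType := {eq_quot QPiso}.
HB.instance Definition _ := Choice.on qp.
HB.instance Definition _ := EqQuotient.on qp.

Definition isoclass (P : QP) : qp := \pi_qp P.

Lemma isoclassP (P Q : QP) : reflect (isoclass P = isoclass Q) (QPiso P Q).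
Proof. exact: (@eqmodP _ QPiso_equivRel). Qed.

Lemma isoclass_repr (p : qp) : isoclass (repr p) = p.
Proof. exact: reprK. Qed.

Lemma repr_isoclass (P : QP) : QPiso (repr (isoclass P)) P.
Proof. by apply/isoclassP; rewrite isoclass_repr. Qed.

Definition qpone : qp := isoclass QPone.
Definition qpmul (p q : qp) : qp := isoclass (QPmul (repr p) (repr q)).

Lemma qpmulE (P Q : QP) :
  qpmul (isoclass P) (isoclass Q) = isoclass (QPmul P Q).
Proof.
have bs m n : bijective (@split m n).
  by exists (@unsplit m n); [apply: splitK | apply: unsplitK].
apply/isoclassP; apply: qiso_trans (qiso_pull _ (bs _ _)) _.
apply: qiso_trans (qiso_sym_imp (qiso_pull _ (bs _ _))).
by apply: qsum_iso; apply: repr_isoclass.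
Qed.

Fact qpmulA : associative qpmul.
Proof.
move=> p q r; rewrite -(isoclass_repr p) -(isoclass_repr q) -(isoclass_repr r).
by rewrite !qpmulE QPmulA.
Qed.

Fact qpmul1 : right_id qpone qpmul.
Proof. by move=> p; rewrite -(isoclass_repr p) qpmulE QPmul1. Qed.

Fact qp1mul : left_id qpone qpmul.
Proof. by move=> p; rewrite -(isoclass_repr p) qpmulE QP1mul. Qed.

Fact qpunit p q : qpmul p q = qpone -> p = qpone /\ q = qpone.
Proof.
rewrite -(isoclass_repr p) -(isoclass_repr q) qpmulE => /isoclassP.
case/qisoP=> f /bij_eq_card; rewrite !card_ord /= => /eqP; rewrite addn_eq0.
by case/andP=> /eqP h /eqP k _; rewrite (QP_size0 h) (QP_size0 k).
Qed.

HB.instance Definition _ :=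
  Choice_isMonomialDef.Build qp qpmulA qp1mul qpmul1 qpunit.

(** The vector space with basis [X] is [{malg K[X]}] and the tensor product of
    those with bases [X] and [Y] is the one with basis [X * Y].  When [X] and
    [Y] are monoids, the monoid algebra of [X * Y] is the tensor product of the
    algebras, see [tensM]. *)

Section MonomProd.
Variables M N : monomType.
Local Open Scope monom_scope.
Definition prod_mone : M * N := (mone, mone).
Definition prod_mmul (x y : M * N) : M * N := (mmul x.1 y.1, mmul x.2 y.2).
Fact prod_mmulA : associative prod_mmul.
Proof. by move=> x y z; rewrite /prod_mmul /= !mulmA. Qed.
Fact prod_mul1m : left_id prod_mone prod_mmul.
Proof. by case=> x y; rewrite /prod_mmul /= !mul1m. Qed.
Fact prod_mulm1 : right_id prod_mone prod_mmul.
Proof. by case=> x y; rewrite /prod_mmul /= !mulm1. Qed.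
Fact prod_unitm x y : prod_mmul x y = prod_mone ->
  x = prod_mone /\ y = prod_mone.
Proof.
by case: x y => [x x'] [y y'] [/unitm[-> ->] /unitm[-> ->]].
Qed.
HB.instance Definition _ := Choice_isMonomialDef.Build (M * N)%type
  prod_mmulA prod_mul1m prod_mulm1 prod_unitm.
End MonomProd.

Section LinExt.
Variables (K : fieldType) (X : choiceType) (V : lmodType K).

Definition linext (f : X -> V) (g : {malg K[X]}) : V :=
  \sum_(x <- msupp g) g@_x *: f x.

Lemma linextEw (f : X -> V) (g : {malg K[X]}) (d : {fset X}) :
  (msupp g `<=` d)%fset -> linext f g = \sum_(x <- d) g@_x *: f x.
Proof.
move=> gd; rewrite /linext; apply: big_fset_incl => // x _ /mcoeff_outdom ->.
by rewrite scale0r.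
Qed.

Fact linext_is_linear (f : X -> V) : linear (linext f).
Proof.
move=> a u v; pose d := (msupp (a *: u + v) `|` (msupp u `|` msupp v))%fset.
have [d1 d2 d3] : [/\ (msupp (a *: u + v) `<=` d)%fset,
    (msupp u `<=` d)%fset & (msupp v `<=` d)%fset].
  split; first exact: fsubsetUl.
    by rewrite fsubsetU // fsubsetUl orbT.
  by rewrite fsubsetU // fsubsetUr orbT.
rewrite (linextEw _ d1) (linextEw _ d2) (linextEw _ d3) scaler_sumr -big_split.
by apply: eq_bigr => x _ /=; rewrite mcoeffD mcoeffZ scalerDl scalerA.
Qed.

HB.instance Definition _ f :=
  GRing.isLinear.Build K {malg K[X]} V _ (linext f) (linext_is_linear f).

Lemma linextU (f : X -> V) x : linext f << x >> = f x.
Proof.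
by rewrite (linextEw _ msuppU_le) big_seq_fset1 mcoeffUU scale1r.
Qed.
End LinExt.

Section MalgLinear.
Variable K : fieldType.

Lemma malg_linind (X : choiceType) (S : {malg K[X]} -> Prop) :
  S 0 -> (forall x, S << x >>) ->
  (forall a u v, S u -> S v -> S (a *: u + v)) -> forall u, S u.
Proof.
move=> S0 SU SL u; have -> : u = linext (fun x => << x >>) u.
  rewrite [LHS]monalgE; apply: eq_bigr => x _; apply/malgP=> k.
  by rewrite mcoeffZ !mcoeffU mulrnAr mulr1.
rewrite /linext; elim: (msupp u : seq X) => [|y r IH]; first by rewrite big_nil.
by rewrite big_cons; apply: SL.
Qed.

Lemma malg_scalerAr (M : monomType) (a : K) (u v : {malg K[M]}) :
  u * (a *: v) = a *: (u * v).
Proof.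
rewrite (malgMEw (fsubset_refl _) (msuppZ_le a v)) malgME scaler_sumr.
apply: eq_bigr => x _; rewrite scaler_sumr; apply: eq_bigr => y _.
apply/malgP=> k; rewrite !mcoeffZ !mcoeffU.
by rewrite mulrnAr mulrCA.
Qed.

Lemma malgUM (M : monomType) (x y : M) :
  << x >> * << y >> = << mmul x y >> :> {malg K[M]}.
Proof. by rewrite malgM_def fgmulUU mulr1. Qed.
End MalgLinear.

Section Tensor.
Variable K : fieldType.

Definition tens (X Y : choiceType) (u : {malg K[X]}) (v : {malg K[Y]}) :
    {malg K[(X * Y)%type]} :=
  linext (fun x => linext (fun y => << (x, y) >>) v) u.

Lemma tensU (X Y : choiceType) (x : X) (y : Y) :
  tens << x >> << y >> = << (x, y) >>.
Proof. by rewrite /tens !linextU. Qed.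

Lemma tens0l (X Y : choiceType) (v : {malg K[Y]}) :
  tens (0 : {malg K[X]}) v = 0.
Proof. exact: linear0. Qed.

Lemma tens_linl (X Y : choiceType) (a : K) (u u' : {malg K[X]})
  (v : {malg K[Y]}) : tens (a *: u + u') v = a *: tens u v + tens u' v.
Proof. exact: linearP. Qed.

Lemma tens_linr (X Y : choiceType) (a : K) (u : {malg K[X]})
  (v v' : {malg K[Y]}) : tens u (a *: v + v') = a *: tens u v + tens u v'.
Proof.
have tE w : tens u w =
    \sum_(x <- msupp u) u@_x *: linext (fun y => << (x, y) >>) w by [].
rewrite !tE scaler_sumr -big_split; apply: eq_bigr => x _.
by rewrite linearP scalerDr !scalerA mulrC.
Qed.

Lemma tens0r (X Y : choiceType) (u : {malg K[X]}) :
  tens u (0 : {malg K[Y]}) = 0.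
Proof.
have := tens_linr (-1) u (0 : {malg K[Y]}) 0.
by rewrite scaler0 add0r scaleN1r addNr.
Qed.

Lemma tensM (M N : monomType) (a c : {malg K[M]}) (b d : {malg K[N]}) :
  tens a b * tens c d = tens (a * c) (b * d).
Proof.
elim/malg_linind: a => [|x|k u v hu hv]; first by rewrite tens0l !mul0r tens0l.
  elim/malg_linind: c => [|y|k u v hu hv].
  - by rewrite tens0l !mulr0 tens0l.
  - elim/malg_linind: b => [|z|k u v hu hv].
    + by rewrite tens0r !mul0r tens0r.
    + elim/malg_linind: d => [|t|k u v hu hv].
      * by rewrite tens0r !mulr0 tens0r.
      * by rewrite !tensU !malgUM tensU.
      * by rewrite tens_linr !mulrDr !malg_scalerAr tens_linr hu hv.
    + by rewrite tens_linr !mulrDl -!scalerAl tens_linr hu hv.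
  - by rewrite tens_linl !mulrDr !malg_scalerAr tens_linl hu hv.
by rewrite tens_linl !mulrDl -!scalerAl tens_linl hu hv.
Qed.

(** [f \otimes g] *)
Definition tmap (X X' Y Y' : choiceType)
    (f : {malg K[X]} -> {malg K[X']}) (g : {malg K[Y]} -> {malg K[Y']}) :
    {malg K[(X * Y)%type]} -> {malg K[(X' * Y')%type]} :=
  linext (fun z : X * Y => tens (f << z.1 >>) (g << z.2 >>)).

(** [f \otimes id] and [id \otimes f] for a linear form [f], with the
    identifications of [K \otimes V] and [V \otimes K] with [V] *)
Definition tcontrl (X Y : choiceType) (f : {malg K[X]} -> K) :
    {malg K[(X * Y)%type]} -> {malg K[Y]} :=
  linext (fun z : X * Y => f << z.1 >> *: << z.2 >>).
Definition tcontrr (X Y : choiceType) (f : {malg K[Y]} -> K) :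
    {malg K[(X * Y)%type]} -> {malg K[X]} :=
  linext (fun z : X * Y => f << z.2 >> *: << z.1 >>).

Definition tassoc (X Y Z : choiceType) :
    {malg K[((X * Y) * Z)%type]} -> {malg K[(X * (Y * Z))%type]} :=
  linext (fun z : (X * Y) * Z => << (z.1.1, (z.1.2, z.2)) >>).

(** [a1 \otimes b1 \otimes a2 \otimes b2 |-> a1 \otimes a2 \otimes b1 b2] *)
Definition m324 (M N : monomType) :
    {malg K[((M * N) * (M * N))%type]} -> {malg K[((M * M) * N)%type]} :=
  linext (fun z : (M * N) * (M * N) =>
    tens (tens << z.1.1 >> << z.2.1 >>) (<< z.1.2 >> * << z.2.2 >>)).
End Tensor.

(** Coalgebra structure maps on the monoid algebra [{malg K[M]}], whose product
    and unit are those of the ring structure. *)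
Record coalg_ops (K : fieldType) (M : monomType) := CoalgOps {
  comul : {linear {malg K[M]} -> {malg K[(M * M)%type]}};
  counit : {linear {malg K[M]} -> K^o} }.

Record is_bialgebra (K : fieldType) (M : monomType) (A : coalg_ops K M) :
    Prop := IsBialgebra {
  bialg_coassoc : forall a : {malg K[M]},
    tassoc (tmap (comul A) id (comul A a)) = tmap id (comul A) (comul A a);
  bialg_counitl : forall a : {malg K[M]}, tcontrl (counit A) (comul A a) = a;
  bialg_counitr : forall a : {malg K[M]}, tcontrr (counit A) (comul A a) = a;
  bialg_comul1 : comul A 1 = tens 1 1;
  bialg_comulM : forall a b : {malg K[M]},
    comul A (a * b) = comul A a * comul A b;
  bialg_counit1 : counit A 1 = 1 :> K;
  bialg_counitM : forall a b : {malg K[M]},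
    counit A (a * b) = (counit A a : K) * (counit A b : K) }.

Record is_coaction (K : fieldType) (M N : monomType) (B : coalg_ops K N)
    (rho : {linear {malg K[M]} -> {malg K[(M * N)%type]}}) : Prop :=
  IsCoaction {
  coaction_coassoc : forall a : {malg K[M]},
    tassoc (tmap rho id (rho a)) = tmap id (comul B) (rho a);
  coaction_counit : forall a : {malg K[M]}, tcontrr (counit B) (rho a) = a }.

Record cointeraction (K : fieldType) (M N : monomType)
    (A : coalg_ops K M) (B : coalg_ops K N)
    (rho : {linear {malg K[M]} -> {malg K[(M * N)%type]}}) : Prop :=
  Cointeraction {
  coint_bialgl : is_bialgebra A;
  coint_bialgr : is_bialgebra B;
  coint_coaction : is_coaction B rho;
  coint_unit : rho 1 = tens 1 1;
  coint_comul : forall a : {malg K[M]},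
    m324 (tmap rho rho (comul A a)) = tmap (comul A) id (rho a);
  coint_mul : forall a b : {malg K[M]}, rho (a * b) = rho a * rho b;
  coint_counit : forall a : {malg K[M]},
    tcontrl (counit A) (rho a) = (counit A a : K) *: 1 }.

Section QuasiPosetBialgebras.
Variable K : fieldType.

Definition comul_QP : {malg K[QP]} -> {malg K[(QP * QP)%type]} :=
  linext (fun P : QP => \sum_(O in qtop (tagged P))
    << (QPstd (tagged P) (~: O), QPstd (tagged P) O) >>).
HB.instance Definition _ := GRing.Linear.on comul_QP.

Definition counit_QP : {malg K[QP]} -> K^o :=
  linext (fun P : QP => (P == QPone)%:R : K^o).
HB.instance Definition _ := GRing.Linear.on counit_QP.

Definition delta_of (P : QP) : {malg K[(qp * qp)%type]} :=
  \sum_(e : eqv 'I_(tag P) | admissible (tagged P) e)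
    << (isoclass (QPquot e), isoclass (QPcut e)) >>.

(* Independent of the choice of representatives, see [comul_qpE]. *)
Definition comul_qp : {malg K[qp]} -> {malg K[(qp * qp)%type]} :=
  linext (fun p : qp => delta_of (repr p)).
HB.instance Definition _ := GRing.Linear.on comul_qp.

Definition counit_qp : {malg K[qp]} -> K^o :=
  linext (fun p : qp => (qdiscrete (tagged (repr p)))%:R : K^o).
HB.instance Definition _ := GRing.Linear.on counit_qp.

Definition rho_QP : {malg K[QP]} -> {malg K[(QP * qp)%type]} :=
  linext (fun P : QP => \sum_(e : eqv 'I_(tag P) | admissible (tagged P) e)
    << (QPquot e, isoclass (QPcut e)) >>).
HB.instance Definition _ := GRing.Linear.on rho_QP.

Lemma delta_of_iso (P Q : QP) : QPiso P Q -> delta_of P = delta_of Q.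
Proof.
case/qisoP=> f bf PQ; have [g fg gf] := bf.
rewrite /delta_of (reindex (eqv_pull f)) /=; last first.
  exists (eqv_pull g) => e _; apply/val_inj/qorderP=> x y.
    by rewrite !eqv_pullE !gf.
  by rewrite !eqv_pullE !fg.
apply: eq_big => e; first exact: (admissible_pull bf PQ).
move=> _; congr << (_, _) >>; apply/isoclassP/qisoP; exists f => //= x y.
  exact: (qquot_pull bf PQ).
exact: (qcut_pull PQ).
Qed.

Lemma comul_qpE (P : QP) : comul_qp << isoclass P >> = delta_of P.
Proof. by rewrite /comul_qp linextU (delta_of_iso (repr_isoclass P)). Qed.

Lemma counit_qpE (P : QP) :
  counit_qp << isoclass P >> = (qdiscrete (tagged P))%:R.
Proof.
rewrite /counit_qp linextU; congr (nat_of_bool _)%:R.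
have imp (P1 P2 : QP) :
    QPiso P1 P2 -> qdiscrete (tagged P1) -> qdiscrete (tagged P2).
  case/qisoP=> f [g fg gf] PQ dP; apply/forallP=> x; apply/forallP=> y.
  have /eqP := forallP (forallP dP (g x)) (g y).
  by rewrite /qsim !PQ !gf => {1}->.
by apply/idP/idP; apply: imp; [|apply: qiso_sym_imp]; apply: repr_isoclass.
Qed.

Definition HQP : coalg_ops K QP := CoalgOps comul_QP counit_QP.
Definition Hqp : coalg_ops K qp := CoalgOps comul_qp counit_qp.
End QuasiPosetBialgebras.

(* Main.v *)
From HB Require Import structures.
Require Import Defs.
From mathcomp Require Import all_boot all_order all_algebra.
From mathcomp.multinomials Require Import monalg.

(** All the structure maps are sums over combinatorial data, so that each axiom
    of a bialgebra, of a coaction and of a cointeraction reduces, by linearity,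
    to a reindexing of sums attached to one quasi-poset [P], or to two for the
    axioms about products.

    The two axioms of coassociativity that involve [delta_of] rest on one
    bijection.  Choosing [e] with [e] admissible for [P], then [f] admissible
    for [P/e], is the same as choosing [f] admissible for [P], then [e]
    admissible for [P|f] ([admissible_nested]).  In both cases [e] is contained
    in [f], and then [(P/e)/f = P/f], [(P|f)|e = P|e] and
    [(P/e)|f = (P|f)/e].  These are equalities of relations on the ground set,
    not only isomorphisms: the same lemma [big_nested] serves for [rho_QP] and,
    after passing to isoclasses on the left, for [comul_qp].  To make the proof
    short, connectedness of classes is first restated as reachability
    by zigzags of [P] inside the class ([qconnected_eclass], [admissibleP]).

    The counits amount to the two extreme admissible equivalences: [P|e] is
    discrete only when [e] is the equivalence of [P] itself, in which case
    [P/e = P], and [P/e] is discrete only when the classes of [e] are the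
    connected components, in which case [P|e = P].

    Compatibility with the product and with the coproduct of quasi-posets are
    two uses of one lemma about a ground set cut into a part and an open part
    ([big_glue]): an admissible equivalence that does not mix the two parts is
    a pair of admissible equivalences, one on each part, and both quotient and
    cut are computed part by part.  For the product, both blocks are open and
    connected classes cannot meet both ([big_admissible_mul]).  For the
    coproduct, [O] is open for [P/e] exactly when it is open for [P] and is a
    union of classes of [e] ([qtop_qquot], [big_admissible_comul]).

    Coassociativity of the coproduct of quasi-posets is the description of both
    sides as sums over flags of two open sets ([big_flags]), and its
    multiplicativity holds because the open sets of a product are the pairs of
    open sets ([big_qtop_mul]). *)

Set Implicit Arguments.
Unset Strict Implicit.
Unset Printing Implicit Defensive.

Import GRing.Theory.

(** * Reachability *)

(** The universal property behind most inclusions below. *)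
Lemma connect_sub_trans (T : finType) (r s : rel T) :
  reflexive s -> transitive s -> (forall x y, r x y -> s x y) ->
  forall x y, connect r x y -> s x y.
Proof.
move=> sr st rs x y /connectP[p]; elim: p x => [|z p IH] x /= => [_ -> //|].
by case/andP=> /rs xz pz ey; apply: st xz (IH _ pz ey).
Qed.

Lemma connect_mono (T : finType) (r s : rel T) :
  (forall x y, r x y -> s x y) -> forall x y, connect r x y -> connect s x y.
Proof. by move=> rs; apply: connect_sub => x y /rs /connect1. Qed.

(** A path that starts in a part of the ground set closed under successors stays
    there, so reachability may be computed inside the part. *)
Lemma connect_inj_up (T U : finType) (f : U -> T) (r : rel T) :
  injective f -> (forall u y, r (f u) y -> exists v, y = f v) ->
  forall u v, connect r (f u) (f v) = connect (fun a b => r (f a) (f b)) u v.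
Proof.
move=> fI up u v; apply/idP/idP; last first.
  apply: (@connect_sub_trans _ _ (fun a b => connect r (f a) (f b))) => [a|b a c|a b].
  - exact: connect0.
  - exact: connect_trans.
  - exact: connect1.
case/connectP=> p; elim: p u => [|y p IH] u /= => [_ /fI ->|].
  exact: connect0.
case/andP=> uy; have [w yw] := up _ _ uy; rewrite yw => py ev.
by apply: connect_trans (IH _ py ev); apply: connect1; rewrite -yw.
Qed.

Lemma connect_inj_down (T U : finType) (f : U -> T) (r : rel T) :
  injective f -> (forall u y, r y (f u) -> exists v, y = f v) ->
  forall u v, connect r (f u) (f v) = connect (fun a b => r (f a) (f b)) u v.
Proof.
move=> fI down u v.
have := @connect_inj_up _ _ f (fun x y => r y x) fI down v u.
by rewrite (connect_rev r) (connect_rev (fun a b => r (f a) (f b))).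
Qed.

(** * Admissible equivalences *)

(** Connectedness inside a class of [e] forgets the direction of [P]. *)
Definition zigzag (T : finType) (P e : rel T) : rel T :=
  connect (fun x y => e x y && (P x y || P y x)).

Lemma zigzag_sym (T : finType) (P e : rel T) : symmetric e -> symmetric (zigzag P e).
Proof.
move=> se; suff imp x y : zigzag P e x y -> zigzag P e y x.
  by move=> x y; apply/idP/idP; apply: imp.
rewrite /zigzag; move: x y; apply: connect_sub_trans => [x|y x z|x y].
- exact: connect0.
- by move=> a b; apply: connect_trans b a.
- by move=> h; apply: connect1; rewrite se orbC.
Qed.

(** The points reached by zigzags from [x] form a clopen subset of the class, and
    conversely a zigzag cannot leave a clopen subset. *)
Lemma qconnected_eclass (T : finType) (P : qorder T) (e : eqv T) x :
  qconnected (qrestr P (eclass e x)) = [forall y, e x y ==> zigzag P e x y].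
Proof.
apply/idP/forallP => [/forall_inP cP y|h].
  apply/implyP=> exy.
  have mx : x \in eclass e x by rewrite inE qle_refl.
  have my : y \in eclass e x by rewrite inE.
  (* connectedness is tested on the points that zigzags from [x] reach *)
  pose O := [set z : {z | z \in eclass e x} | zigzag P e x (val z)].
  have clop (a b : {z | z \in eclass e x}) :
      P (val a) (val b) || P (val b) (val a) -> a \in O -> b \in O.
    rewrite !inE => ab xa; apply: connect_trans xa _; apply: connect1.
    case: a b ab => [a ma] [b mb] /= ->; rewrite andbT.
    by move: ma mb; rewrite !inE => ma mb; apply: qle_trans mb; rewrite eqv_sym.
  have oO : O \in qtop (qrestr P (eclass e x)).
    rewrite inE; apply/forall_inP=> a aO; apply/forallP=> b; apply/implyP.
    by rewrite qpullE => ab; apply: clop aO; rewrite ab.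
  have oC : ~: O \in qtop (qrestr P (eclass e x)).
    rewrite inE; apply/forall_inP=> a; rewrite inE => aO.
    apply/forallP=> b; apply/implyP; rewrite inE qpullE => ab.
    by apply: contra aO; apply: clop; rewrite ab orbT.
  have /implyP/(_ oC)/orP[] := cP _ oO => /eqP/setP.
    by move/(_ (Sub x mx)); rewrite !inE /= [zigzag _ _ _ _]connect0.
  by move/(_ (Sub y my)); rewrite !inE /=.
apply/forall_inP=> O oO; apply/implyP=> oC.
have step (a b : {z | z \in eclass e x}) :
    P (val a) (val b) || P (val b) (val a) -> a \in O -> b \in O.
  case/orP=> ab aO.
    by move: oO; rewrite inE => /forall_inP/(_ _ aO)/forallP/(_ b); rewrite qpullE ab.
  apply: contraTT aO => bO; move: oC; rewrite inE => /forall_inP/(_ b).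
  by rewrite inE => /(_ bO)/forallP/(_ a); rewrite qpullE ab inE.
have path_in (a b : {z | z \in eclass e x}) : zigzag P e (val a) (val b) -> a \in O -> b \in O.
  case/connectP=> p; elim: p a => [|z p IH] a /=.
    by move=> _ /val_inj ->.
  case/andP=> /andP[az Paz] pz eb aO.
  have mz : z \in eclass e x.
    by case: (a) az => a' /=; rewrite !inE; apply: qle_trans.
  by apply: (IH (Sub z mz)) => //; apply: step aO.
case: (set_0Vmem O) => [-> | [a aO]]; first by rewrite eqxx.
apply/orP; right; apply/eqP/setP=> b; rewrite inE.
have xz (c : {z | z \in eclass e x}) : zigzag P e x (val c).
  by case: c => c /=; rewrite inE => /(implyP (h c)).
apply: path_in aO; apply: connect_trans (xz b).
by rewrite -/(zigzag P e _ _) zigzag_sym //; exact: eqv_sym.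
Qed.

Section Admissible.
Variable T : finType.
Implicit Types (P : qorder T) (e f : eqv T).

Lemma qquotE P e x y : qquot P e x y = connect (fun a b => P a b || e a b) x y.
Proof. exact: mk_qorderE. Qed.

Lemma qcutE P e x y : qcut P e x y = P x y && e x y.
Proof. exact: mk_qorderE. Qed.

Lemma qquot_le P e x y : P x y -> qquot P e x y.
Proof. by rewrite qquotE => h; apply: connect1; rewrite h. Qed.

Lemma qquot_eqv P e x y : e x y -> qquot P e x y.
Proof. by rewrite qquotE => h; apply: connect1; rewrite h orbT. Qed.

Lemma qquot_min P e (s : qorder T) : (forall x y, P x y -> s x y) ->
  (forall x y, e x y -> s x y) -> forall x y, qquot P e x y -> s x y.
Proof.
move=> Ps es x y; rewrite qquotE; move: x y; apply: connect_sub_trans => [x|y x z|x y].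
- exact: qle_refl.
- exact: qle_trans.
- by case/orP=> [/Ps|/es].
Qed.

(** The half of the condition on the equivalence of [P/e] that is not automatic:
    related points are always equivalent in the quotient. *)
Definition saturates P e := forall x y, qquot P e x y -> qquot P e y x -> e x y.

Lemma admissibleP P e :
  reflect ((forall x y, e x y -> zigzag P e x y) /\ saturates P e) (admissible P e).
Proof.
apply: (iffP andP) => [] [c s]; split.
- move=> x y exy; have := forallP c x; rewrite qconnected_eclass.
  by move/forallP/(_ y)/implyP; apply.
- by move=> x y xy yx; rewrite -(eqP (forallP (forallP s x) y)) /qsim xy yx.
- apply/forallP=> x; rewrite qconnected_eclass; apply/forallP=> y.
  by apply/implyP/c.
- apply/forallP=> x; apply/forallP=> y; apply/eqP; apply/idP/idP=> [/andP[]|exy]; first exact: s.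
  by rewrite /qsim !qquot_eqv // eqv_sym.
Qed.

Fact mk_eqv_subproof (q : qorder T) : symmetric q ->
  [forall x, forall y, q x y ==> q y x].
Proof. by move=> s; apply/forallP=> x; apply/forallP=> y; rewrite s implybb. Qed.

Definition mk_eqv (q : qorder T) (s : symmetric q) : eqv T :=
  exist (fun q : qorder T => [forall x, forall y, q x y ==> q y x])
    q (mk_eqv_subproof s).

Lemma eqvP e f : (forall x y, e x y = f x y) -> e = f.
Proof. by move=> ef; apply/val_inj/qorderP. Qed.

Lemma qquot_mono P e f : (forall x y, e x y -> f x y) ->
  forall x y, qquot P e x y -> qquot P f x y.
Proof.
move=> ef; apply: qquot_min => x y; first exact: qquot_le.
by move/ef; apply: qquot_eqv.
Qed.

Lemma admissible_cut_sub P e f :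
  admissible (qcut P f) e -> forall x y, e x y -> f x y.
Proof.
case/admissibleP=> c _ x y /c; apply: connect_sub_trans => [a|b a d|a b].
- exact: qle_refl.
- exact: qle_trans.
- by rewrite !qcutE => /andP[_ /orP[]/andP[_ //]]; rewrite eqv_sym.
Qed.

End Admissible.

Section Nested.
Variable T : finType.
Variables (P : qorder T) (e f : eqv T).
Hypothesis ef : forall x y, e x y -> f x y.

Lemma qquot_qquot : qquot (qquot P e) f = qquot P f.
Proof.
apply/qorderP=> x y; apply/idP/idP; apply: qquot_min => a b.
- exact: qquot_mono.
- exact: qquot_eqv.
- by move=> ab; do 2!apply: qquot_le.
- exact: qquot_eqv.
Qed.

Lemma qcut_qcut : qcut (qcut P f) e = qcut P e.
Proof.
apply/qorderP=> x y; rewrite !qcutE -andbA; congr andb.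
by apply/andP/idP=> [[]//|exy]; rewrite ef.
Qed.

(** The nontrivial inclusion needs the saturation of [f]: a path of [P/e] between
    two points of a class of [f] is a closed loop in [P/f], so all its points lie
    in that class. *)
Lemma qcut_qquot : saturates P f -> qcut (qquot P e) f = qquot (qcut P f) e.
Proof.
move=> sf; apply/qorderP=> x y; rewrite qcutE; apply/andP/idP=> [[]|xy]; last first.
  split; move: x y xy; apply: qquot_min => a b.
  - by rewrite qcutE => /andP[ab _]; apply: qquot_le.
  - exact: qquot_eqv.
  - by rewrite qcutE => /andP[].
  - exact: ef.
rewrite {1}qquotE => /connectP[p]; elim: p x => [|z p IH] x /=.
  by move=> _ -> _; apply: qle_refl.
case/andP=> xz pz ey fxy.
have zy : qquot P e z y by rewrite qquotE; apply/connectP; exists p.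
have xz' : qquot P f x z by case/orP: xz => [/qquot_le|/ef/qquot_eqv].
have fxz : f x z.
  by apply: sf => //; apply: qle_trans (qquot_mono ef zy) _; rewrite qquot_eqv // eqv_sym.
have fzy : f z y by apply: qle_trans fxy; rewrite eqv_sym.
apply: qle_trans (IH z pz ey fzy).
by case/orP: xz => h; [apply: qquot_le; rewrite qcutE h | apply: qquot_eqv].
Qed.
End Nested.

(** Each side forces [e] to be contained in [f], so that the three identities above
    apply.  The condition that takes work is the connectedness of the classes of
    [f]: a zigzag of [P/e] has to be expanded into a zigzag of [P]. *)
Lemma admissible_nested (T : finType) (P : qorder T) (e f : eqv T) :
  admissible P e && admissible (qquot P e) f =
  admissible P f && admissible (qcut P f) e.
Proof.
apply/andP/andP=> [] [/admissibleP[c s] /admissibleP[c' s']].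
  have ef x y : e x y -> f x y.
    by move=> exy; apply: s'; apply: qquot_le; apply: qquot_eqv => //; rewrite eqv_sym.
  have sf : saturates P f by move=> x y; rewrite -(qquot_qquot P ef); apply: s'.
  split; apply/admissibleP; split=> //.
  - move=> x y /c'; move: x y; apply: connect_sub_trans => [x|y x z|x y].
    + exact: connect0.
    + exact: connect_trans.
    (* a step of [P/e] inside a class of [f] is a path inside that class, made
       of steps of [P] and of steps of [e]; the latter are zigzags of [P] *)
    have go a b : qcut (qquot P e) f a b -> zigzag P f a b.
      rewrite qcut_qquot // qquotE; move: a b.
      apply: connect_sub_trans => [a|b a d|a b]; first exact: connect0.
        exact: connect_trans.
      rewrite qcutE => /orP[/andP[Pab fab]|/c].
        by apply: connect1; rewrite fab Pab.
      apply: connect_mono => u v /andP[uv ->]; by rewrite ef.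
    case/andP=> fxy /orP[] h; first by apply: go; rewrite qcutE h.
    rewrite -/(zigzag P f x y) zigzag_sym; last exact: eqv_sym.
    by apply: go; rewrite qcutE h eqv_sym.
  - move=> x y /c; apply: connect_mono => a b /andP[eab h].
    by rewrite !qcutE eab !(ef _ _ eab) eqv_sym (ef _ _ eab) !andbT.
  - move=> x y; rewrite -qcut_qquot // !qcutE => /andP[xy _] /andP[yx _].
    exact: s.
have ef : forall x y, e x y -> f x y.
  by apply: (admissible_cut_sub (P := P)); apply/admissibleP.
split; apply/admissibleP; split.
- move=> x y /c'; apply: connect_mono => a b /andP[-> /=].
  by rewrite !qcutE => /orP[]/andP[-> _]; rewrite ?orbT.
- move=> x y xy yx.
  have fxy : f x y by apply: s; apply: (qquot_mono ef).
  by apply: s'; rewrite -qcut_qquot // qcutE ?xy ?yx // eqv_sym.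
- move=> x y /c; apply: connect_mono => a b /andP[-> /=].
  by case/orP=> h; rewrite (qquot_le _ h) ?orbT.
- by move=> x y; rewrite qquot_qquot //; apply: s.
Qed.

(** * The extreme admissible equivalences *)

Section Extreme.
Variables (T : finType) (P : qorder T).

Fact sim_refl : reflexive (qsim P).
Proof. by move=> x; rewrite /qsim qle_refl. Qed.
Fact sim_trans : transitive (qsim P).
Proof.
by move=> y x z /andP[xy yx] /andP[yz zy]; rewrite /qsim (qle_trans xy yz) (qle_trans zy yx).
Qed.
Fact sim_sym : symmetric (mk_qorder sim_refl sim_trans).
Proof. by move=> x y; rewrite !mk_qorderE /qsim andbC. Qed.
Definition sim_eqv : eqv T := mk_eqv sim_sym.
Lemma sim_eqvE x y : sim_eqv x y = qsim P x y. Proof. exact: mk_qorderE. Qed.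

Definition comp_qorder :=
  mk_qorder (@connect0 T (fun x y => P x y || P y x))
            (@connect_trans T (fun x y => P x y || P y x)).
Fact comp_sym : symmetric comp_qorder.
Proof.
move=> x y; rewrite !mk_qorderE.
exact: (zigzag_sym P (e := fun _ _ => true)).
Qed.
Definition comp_eqv : eqv T := mk_eqv comp_sym.
Lemma comp_eqvE x y : comp_eqv x y = connect (fun x y => P x y || P y x) x y.
Proof. exact: mk_qorderE. Qed.

Lemma qdiscreteP : reflect (symmetric P) (qdiscrete P).
Proof.
apply: (iffP forallP) => [d|s x].
  have imp x y : P x y -> P y x by rewrite (eqP (forallP (d x) y)) => /andP[].
  by move=> x y; apply/idP/idP; apply: imp.
by apply/forallP=> y; rewrite /qsim s andbb.
Qed.

Lemma qquot_sim : qquot P sim_eqv = P.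
Proof.
apply/qorderP=> x y; apply/idP/idP; last exact: qquot_le.
by apply: qquot_min => a b //; rewrite sim_eqvE => /andP[].
Qed.

Lemma le_comp x y : P x y -> comp_eqv x y.
Proof. by rewrite comp_eqvE => xy; apply: connect1; rewrite xy. Qed.

Lemma qcut_comp : qcut P comp_eqv = P.
Proof.
apply/qorderP=> x y; rewrite qcutE; apply/andP/idP=> [[]//|xy].
by rewrite xy le_comp.
Qed.

Lemma qquot_comp : qquot P comp_eqv = comp_eqv.
Proof.
apply/qorderP=> x y; apply/idP/idP; last exact: qquot_eqv.
by apply: qquot_min => a b //; apply: le_comp.
Qed.

(** If [P|e] is discrete, then every step of a zigzag in a class of [e] can be
    reversed in [P], so that the class lies in a class of [P]; the converse
    inclusion holds for every admissible [e]. *)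
Lemma admissible_discrete_cut (e : eqv T) :
  admissible P e && qdiscrete (qcut P e) = (e == sim_eqv).
Proof.
apply/andP/eqP=> [[/admissibleP[c s] /forallP d]|->].
  apply/eqvP=> x y; rewrite sim_eqvE; apply/idP/idP=> [/c|/andP[xy yx]]; last first.
    by apply: s; apply: qquot_le.
  apply: connect_sub_trans => [a|b a z|a b].
  - exact: sim_refl.
  - exact: sim_trans.
  have sd u v : P u v -> e u v -> P v u.
    move=> uv euv; have := eqP (forallP (d u) v).
    by rewrite /qsim !qcutE uv euv /= => /esym/andP[].
  rewrite /qsim => /andP[eab /orP[ab|ba]].
    by rewrite ab (sd _ _ ab eab).
  by rewrite ba (sd _ _ ba) // eqv_sym.
split.
  apply/admissibleP; split=> [x y|x y].
    by rewrite sim_eqvE => xy; apply: connect1; rewrite sim_eqvE xy; case/andP: xy => ->.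
  by rewrite qquot_sim sim_eqvE /qsim => -> ->.
apply/forallP=> x; apply/forallP=> y; rewrite /qsim !qcutE !sim_eqvE /qsim.
by case: (P x y); case: (P y x).
Qed.

(** If [P/e] is discrete, then [P] only relates points of the same class, so each
    class, being connected, is a whole component. *)
Lemma admissible_discrete_quot (e : eqv T) :
  admissible P e && qdiscrete (qquot P e) = (e == comp_eqv).
Proof.
apply/andP/eqP=> [[/admissibleP[c s] /forallP d]|->].
  apply/eqvP=> x y; rewrite comp_eqvE; apply/idP/idP=> [/c|].
    by apply: connect_mono => a b /andP[].
  apply: connect_sub_trans => [a|b a z|a b].
  - exact: qle_refl.
  - exact: qle_trans.
  have sd u v : P u v -> e u v.
    move=> /(qquot_le e) uv; have := eqP (forallP (d u) v).
    by rewrite uv => /esym/andP[]; apply: s.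
  by case/orP=> /sd //; rewrite eqv_sym.
split.
  apply/admissibleP; split=> [x y|x y]; last by rewrite qquot_comp.
  rewrite comp_eqvE; apply: connect_mono => a b h; rewrite h andbT.
  by case/orP: h => /le_comp //; rewrite eqv_sym.
rewrite qquot_comp; apply/forallP=> x; apply/forallP=> y.
by rewrite /qsim (eqv_sym _ y) andbb.
Qed.
End Extreme.

(** * Cutting a quasi-order along an open set *)

(** Open sets that are unions of classes are open in the quotient. *)
Lemma qquot_stable (T : finType) (P : qorder T) (e : eqv T) (A : {pred T}) :
  (forall x y, P x y -> x \in A -> y \in A) ->
  (forall x y, e x y -> x \in A -> y \in A) ->
  forall x y, qquot P e x y -> x \in A -> y \in A.
Proof.
move=> PA eA x y; rewrite qquotE => xy; apply/implyP; move: x y xy.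
apply: connect_sub_trans => [x|y x z|x y].
- exact: implybb.
- by case: (x \in A) => //= ->.
- by move=> /orP[/PA|/eA] h; apply/implyP.
Qed.

(** The ground set [T] is cut into the image of [f] and the image of [g], given by
    injections rather than as subsets, so that standardised restrictions and
    factors of a product are both instances. *)
Section Glue.
Variables (T U V : finType) (f : U -> T) (g : V -> T).

Definition glue (z : U + V) : T := match z with inl u => f u | inr v => g v end.

Definition separated (e : eqv T) : bool := [forall u, forall v, ~~ e (f u) (g v)].

Hypothesis fg_bij : bijective glue.

Lemma glue_injl : injective f.
Proof. by move=> u u' h; have /(bij_inj fg_bij)[] : glue (inl u) = glue (inl u'). Qed.

Lemma glue_injr : injective g.
Proof. by move=> u u' h; have /(bij_inj fg_bij)[] : glue (inr u) = glue (inr u'). Qed.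

Lemma glue_neq u v : f u <> g v.
Proof. by move=> h; have /(bij_inj fg_bij) : glue (inl u) = glue (inr v). Qed.

Lemma glueP (A : T -> Prop) : (forall u, A (f u)) -> (forall v, A (g v)) -> forall y, A y.
Proof. by move=> Af Ag y; case: fg_bij => k _ gk; rewrite -(gk y); case: (k y). Qed.

Section Separated.
Variables (P : qorder T) (e : eqv T).
Hypothesis P_down : forall u v, P (g v) (f u) = false.
Hypothesis e_sep : separated e.

Lemma separatedP u v : e (f u) (g v) = false.
Proof. exact/negbTE/(forallP (forallP e_sep u)). Qed.

(** The image of [f] is closed under predecessors, that of [g] under successors:
    no path between two points of one part visits the other. *)
Lemma qquot_glue_inl u u' :
  qquot P e (f u) (f u') = qquot (qpull f P) (eqv_pull f e) u u'.
Proof.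
rewrite !qquotE (connect_inj_down glue_injl).
  by apply: eq_connect => a b; rewrite eqv_pullE qpullE.
move=> a; apply: glueP => [b _|b]; first by exists b.
by rewrite P_down eqv_sym separatedP.
Qed.

Lemma qquot_glue_inr v v' :
  qquot P e (g v) (g v') = qquot (qpull g P) (eqv_pull g e) v v'.
Proof.
rewrite !qquotE (connect_inj_up glue_injr).
  by apply: eq_connect => a b; rewrite eqv_pullE qpullE.
move=> a; apply: glueP => [b|b _]; last by exists b.
by rewrite P_down eqv_sym separatedP.
Qed.

Lemma zigzag_glue_inl u u' :
  zigzag P e (f u) (f u') = zigzag (qpull f P) (eqv_pull f e) u u'.
Proof.
rewrite /zigzag (connect_inj_up glue_injl).
  by apply: eq_connect => a b; rewrite eqv_pullE !qpullE.
move=> a; apply: glueP => [b _|b]; first by exists b.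
by rewrite separatedP.
Qed.

Lemma zigzag_glue_inr v v' :
  zigzag P e (g v) (g v') = zigzag (qpull g P) (eqv_pull g e) v v'.
Proof.
rewrite /zigzag (connect_inj_up glue_injr).
  by apply: eq_connect => a b; rewrite eqv_pullE !qpullE.
move=> a; apply: glueP => [b|b _]; last by exists b.
by rewrite eqv_sym separatedP.
Qed.

Lemma qquot_glue_down u v : qquot P e (g v) (f u) = false.
Proof.
apply/negP => h; suff: f u \in codom g by case/codomP=> w; apply: glue_neq.
apply: (qquot_stable _ _ h); last exact: codom_f.
  move=> x y xy /codomP[w xw]; move: xy; rewrite {}xw; move: y.
  by apply: glueP => [b|b _]; rewrite ?P_down ?codom_f.
move=> x y xy /codomP[w xw]; move: xy; rewrite {}xw; move: y.
by apply: glueP => [b|b _]; rewrite ?codom_f // eqv_sym separatedP.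
Qed.

Lemma admissible_glue : admissible P e =
  admissible (qpull f P) (eqv_pull f e) && admissible (qpull g P) (eqv_pull g e).
Proof.
apply/admissibleP/andP=> [[c s]|[/admissibleP[cf sf] /admissibleP[cg sg]]].
  split; apply/admissibleP; split=> x y.
  - by rewrite eqv_pullE -zigzag_glue_inl; apply: c.
  - by rewrite -!qquot_glue_inl eqv_pullE; apply: s.
  - by rewrite eqv_pullE -zigzag_glue_inr; apply: c.
  - by rewrite -!qquot_glue_inr eqv_pullE; apply: s.
split; apply: glueP => x; apply: glueP => y.
- by rewrite zigzag_glue_inl -eqv_pullE; apply: cf.
- by rewrite separatedP.
- by rewrite eqv_sym separatedP.
- by rewrite zigzag_glue_inr -eqv_pullE; apply: cg.
- by rewrite !qquot_glue_inl -eqv_pullE; apply: sf.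
- by move=> _; rewrite qquot_glue_down.
- by rewrite qquot_glue_down.
- by rewrite !qquot_glue_inr -eqv_pullE; apply: sg.
Qed.

Lemma qcut_glue :
  qiso (qcut P e) (qsum (qcut (qpull f P) (eqv_pull f e)) (qcut (qpull g P) (eqv_pull g e))).
Proof.
apply: qiso_sym_imp; apply/qisoP; exists glue => // x y.
rewrite [LHS]mk_qorderE qcutE; case: x y => x [] y /=.
- by rewrite qcutE qpullE eqv_pullE.
- by rewrite separatedP andbF.
- by rewrite eqv_sym separatedP andbF.
- by rewrite qcutE qpullE eqv_pullE.
Qed.
End Separated.

Lemma sum_eqv_sym (e1 : eqv U) (e2 : eqv V) : symmetric (qsum e1 e2).
Proof. by case=> x [] y; rewrite !mk_qorderE //= eqv_sym. Qed.

(** The equivalences of [T] that do not mix the two parts are the sums of an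
    equivalence on each part. *)
Lemma big_glue (R : nmodType) (P : qorder T) (F : eqv T -> R)
    (G : eqv U -> eqv V -> R) :
  (forall u v, P (g v) (f u) = false) ->
  (forall e, separated e -> admissible P e -> F e = G (eqv_pull f e) (eqv_pull g e)) ->
  (\sum_(e : eqv T | admissible P e && separated e) F e =
   \sum_(e1 : eqv U | admissible (qpull f P) e1)
     \sum_(e2 : eqv V | admissible (qpull g P) e2) G e1 e2)%R.
Proof.
move=> P_down FG; have [k glueK kK] := fg_bij.
pose join (ee : eqv U * eqv V) := eqv_pull k (mk_eqv (sum_eqv_sym ee.1 ee.2)).
have joinE ee x y : join ee (glue x) (glue y) = qsum ee.1 ee.2 x y.
  by rewrite eqv_pullE !glueK.
rewrite pair_big /= (reindex_onto join (fun e => (eqv_pull f e, eqv_pull g e))) /=; last first.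
  move=> e /andP[_ se]; apply: eqvP => x y; rewrite -(kK x) -(kK y) joinE mk_qorderE.
  by case: (k x) (k y) => a [] b /=; rewrite ?eqv_pullE ?separatedP // eqv_sym separatedP.
have pulls ee : (eqv_pull f (join ee), eqv_pull g (join ee)) = ee.
  case: ee => e1 e2; congr pair; apply: eqvP => x y; rewrite eqv_pullE.
    by rewrite (joinE _ (inl x) (inl y)) mk_qorderE.
  by rewrite (joinE _ (inr x) (inr y)) mk_qorderE.
have sep ee : separated (join ee).
  by apply/forallP=> u; apply/forallP=> v; rewrite (joinE _ (inl u) (inr v)) mk_qorderE.
apply: eq_big => [ee|ee /andP[/andP[a s] _]].
  rewrite pulls eqxx sep !andbT admissible_glue //.
  by have [-> ->] : eqv_pull f (join ee) = ee.1 /\ eqv_pull g (join ee) = ee.2;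
    first by rewrite -{2 4}(pulls ee).
rewrite FG //.
by have [-> ->] : eqv_pull f (join ee) = ee.1 /\ eqv_pull g (join ee) = ee.2;
    first by rewrite -{2 4}(pulls ee).
Qed.
End Glue.

(** * Standardisation *)

(** Only one increasing map between finite ordinals has a given image; so every
    identity between iterated standardisations follows from exhibiting an
    increasing map with the expected image. *)
Lemma QPstd_incr (m n : nat) (P : qorder 'I_n) (g : 'I_m -> 'I_n) (B : {set 'I_n}) :
  (forall i j : 'I_m, i < j -> g i < g j) -> (forall x, (x \in B) = (x \in codom g)) ->
  mkQP (qpull g P) = QPstd P B.
Proof.
move=> gI gB.
have sE k : sorted (fun i j : 'I_k => i < j) (enum 'I_k).
  by have := iota_ltn_sorted 0 k; rewrite -val_enum_ord sorted_map.
have tr k : transitive (fun i j : 'I_k => i < j) by move=> y x z; apply: ltn_trans.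
have eB : enum B = map g (enum 'I_m).
  apply: (irr_sorted_eq (leT := fun i j : 'I_n => i < j)).
  - exact: tr.
  - by move=> i; rewrite /= ltnn.
  - by rewrite {1}/enum_mem; apply: sorted_filter; [apply: tr | have := sE n; rewrite enumT].
  - by apply: homo_sorted gI _ _; apply: sE.
  by move=> x; rewrite mem_enum gB codomE.
have em : #|B| = m by rewrite cardE eB size_map size_enum_ord.
rewrite /QPstd; case: m / em g gI gB eB => g _ _ eB.
congr mkQP; apply/qorderP=> i j; rewrite !qpullE.
have ev (k : 'I_#|B|) : enum_val k = g k.
  have kB : k < size (enum 'I_#|B|) by rewrite size_enum_ord.
  by rewrite /enum_val [X in nth _ X]eB (nth_map k) // nth_ord_enum.
by rewrite !ev.
Qed.

Lemma QPstdT (n : nat) (P : qorder 'I_n) : QPstd P setT = mkQP P.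
Proof.
rewrite -(@QPstd_incr n _ _ id) //; first by congr mkQP; apply/qorderP=> x y; rewrite qpullE.
by move=> x; rewrite inE; apply/esym/codomP; exists x.
Qed.

Lemma QPstd0 (n : nat) (P : qorder 'I_n) : QPstd P set0 = QPone.
Proof. by apply: QP_size0; rewrite /= cards0. Qed.

Lemma QPstd_eq1 (n : nat) (P : qorder 'I_n) B : (QPstd P B == QPone) = (B == set0).
Proof.
apply/eqP/eqP=> [/(congr1 tag) /= /eqP|->]; last exact: QPstd0.
by rewrite cards_eq0 => /eqP.
Qed.

Lemma QPstd_std (n : nat) (P : qorder 'I_n) (B X : {set 'I_n}) :
  QPstd (tagged (QPstd P B)) ((fun i : 'I_#|B| => enum_val i) @^-1: X) = QPstd P (B :&: X).
Proof.
set C := _ @^-1: X.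
rewrite -[RHS](@QPstd_incr #|C| _ P (fun i => enum_val (enum_val i))).
- by congr mkQP; apply/qorderP=> i j; rewrite !qpullE.
- by move=> i j ij; rewrite !enum_val_increasing.
move=> x; apply/setIP/codomP=> [[xB xX]|[i ->]].
  have rC : enum_rank_in xB x \in C by rewrite inE enum_rankK_in.
  by exists (enum_rank_in rC (enum_rank_in xB x)); rewrite !enum_rankK_in.
by split; [apply: enum_valP | have := enum_valP i; rewrite inE].
Qed.

Lemma QPmulE (P Q : QP) x y :
  tagged (QPmul P Q) (unsplit x) (unsplit y) = qsum (tagged P) (tagged Q) x y.
Proof. by rewrite qpullE !unsplitK. Qed.

(** The factors of a product of quasi-posets are parts in the sense of [glue]. *)
Lemma unsplit_bij m n : bijective (glue (@lshift m n) (@rshift m n)).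
Proof.
by exists (@split m n) => x; [rewrite -[RHS]unsplitK | rewrite -[RHS]splitK];
  [case: x | case: split].
Qed.

Lemma QPmulEl (P Q : QP) x y :
  tagged (QPmul P Q) (lshift _ x) (lshift _ y) = tagged P x y.
Proof. by rewrite (@QPmulE P Q (inl x) (inl y)) mk_qorderE. Qed.

Lemma QPmulEr (P Q : QP) x y :
  tagged (QPmul P Q) (rshift _ x) (rshift _ y) = tagged Q x y.
Proof. by rewrite (@QPmulE P Q (inr x) (inr y)) mk_qorderE. Qed.

Lemma QPmulElr (P Q : QP) x y : tagged (QPmul P Q) (lshift _ x) (rshift _ y) = false.
Proof. by rewrite (@QPmulE P Q (inl x) (inr y)) mk_qorderE. Qed.

Lemma QPmulErl (P Q : QP) x y : tagged (QPmul P Q) (rshift _ x) (lshift _ y) = false.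
Proof. by rewrite (@QPmulE P Q (inr x) (inl y)) mk_qorderE. Qed.

Lemma QPmul_pull (P Q : QP) :
  qpull (lshift _) (tagged (QPmul P Q)) = tagged P /\
  qpull (@rshift _ _) (tagged (QPmul P Q)) = tagged Q.
Proof.
by split; apply/qorderP=> x y; rewrite qpullE ?QPmulEl ?QPmulEr.
Qed.

Lemma QPstd_mul (P Q : QP) (X : {set 'I_(tag P + tag Q)}) :
  QPstd (tagged (QPmul P Q)) X =
  QPmul (QPstd (tagged P) ((@lshift _ _) @^-1: X)) (QPstd (tagged Q) ((@rshift _ _) @^-1: X)).
Proof.
set X1 := _ @^-1: X; set X2 := (X in QPstd (tagged Q) X).
pose emb (z : 'I_#|X1| + 'I_#|X2|) : 'I_(tag P + tag Q) :=
  match z with inl i => lshift _ (enum_val i) | inr j => rshift _ (enum_val j) end.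
rewrite -(@QPstd_incr (#|X1| + #|X2|) _ _ (fun i => emb (split i))).
- congr mkQP; apply/qorderP=> i j; rewrite [LHS]qpullE [RHS]qpullE [RHS]mk_qorderE.
  case: (split i) (split j) => a [] b; rewrite /emb /qsum_rel.
  + by rewrite QPmulEl qpullE.
  + by rewrite QPmulElr.
  + by rewrite QPmulErl.
  + by rewrite QPmulEr qpullE.
- move=> i j; case: (splitP i) => a ia; case: (splitP j) => b jb ij /=.
  + by rewrite enum_val_increasing -ia -jb.
  + exact: leq_trans (ltn_ord (enum_val a)) (leq_addr _ _).
  + by move: ij; rewrite ia jb => /ltn_trans/(_ (ltn_ord b)); rewrite ltnNge leq_addr.
  + by rewrite ltn_add2l enum_val_increasing -(ltn_add2l #|X1|) -ia -jb.
move=> x; rewrite -(splitK x); move: (split x) => {}x.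
apply/idP/codomP=> [xX|[i ->]]; last first.
  by case: (split i) => a /=; have := enum_valP a; rewrite inE.
case: x xX => x xX.
  have x1 : x \in X1 by rewrite inE.
  by exists (unsplit (inl (enum_rank_in x1 x))); rewrite unsplitK /= enum_rankK_in.
have x2 : x \in X2 by rewrite inE.
by exists (unsplit (inr (enum_rank_in x2 x))); rewrite unsplitK /= enum_rankK_in.
Qed.

(** * Open sets *)

Lemma qtopP (T : finType) (P : qorder T) (O : {set T}) :
  reflect (forall x y, P x y -> x \in O -> y \in O) (O \in qtop P).
Proof.
rewrite inE; apply: (iffP forall_inP) => [h x y xy xO|h x xO].
  exact: implyP (forallP (h x xO) y) xy.
by apply/forallP=> y; apply/implyP=> xy; apply: h xy xO.
Qed.

Lemma set0_top (T : finType) (P : qorder T) : set0 \in qtop P.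
Proof. by apply/qtopP=> x y _; rewrite inE. Qed.

Lemma setT_top (T : finType) (P : qorder T) : setT \in qtop P.
Proof. by apply/qtopP=> x y _; rewrite inE. Qed.

Section Flags.
Variables (R : nmodType) (n : nat) (P : qorder 'I_n).
Local Notation ev := (fun i => enum_val i).
Local Open Scope ring_scope.

(** For [O] open, a subset of [O] is open in [O] if and only if it is open. *)
Lemma big_qtop_open (O : {set 'I_n}) (H : {set 'I_#|O|} -> R) : O \in qtop P ->
  \sum_(O1 in qtop (tagged (QPstd P O))) H O1 =
  \sum_(O1 in qtop P | O1 \subset O) H (ev @^-1: O1).
Proof.
move/qtopP=> oO; rewrite (reindex_onto (fun O1 : {set 'I_n} => ev @^-1: O1)
  (fun O1 : {set 'I_#|O|} => ev @: O1)) /=.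
  apply: eq_bigl => O1; apply/andP/andP=> [[/qtopP o /eqP <-]|[/qtopP o sO]].
    split; last by apply/subsetP=> x /imsetP[i _ ->]; apply: enum_valP.
    apply/qtopP=> x y xy /imsetP[i iO ex]; rewrite {}ex in xy.
    have yO := oO _ _ xy (enum_valP i).
    apply/imsetP; exists (enum_rank_in yO y); last by rewrite enum_rankK_in.
    by apply: o iO; rewrite qpullE enum_rankK_in.
  split; first by apply/qtopP=> i j; rewrite qpullE !inE; apply: o.
  apply/eqP/setP=> x; apply/imsetP/idP=> [[i]|xO1]; first by rewrite inE => ? ->.
  have xO := subsetP sO _ xO1; exists (enum_rank_in xO x); last by rewrite enum_rankK_in.
  by rewrite inE enum_rankK_in.
by move=> O1 _; apply/setP=> i; rewrite inE mem_imset //; apply: enum_val_inj.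
Qed.

(** For [O] open, adding [O] to an open set of the complement gives an open set. *)
Lemma big_qtop_closed (O : {set 'I_n}) (H : {set 'I_#|~: O|} -> R) : O \in qtop P ->
  \sum_(O2 in qtop (tagged (QPstd P (~: O)))) H O2 =
  \sum_(O2 in qtop P | O \subset O2) H (ev @^-1: O2).
Proof.
move/qtopP=> oO.
rewrite (reindex_onto (fun O2 : {set 'I_n} => ev @^-1: O2)
  (fun O2 : {set 'I_#|~: O|} => O :|: ev @: O2)) /=.
  apply: eq_bigl => O2; apply/andP/andP=> [[/qtopP o /eqP eO]|[/qtopP o sO]].
    split; last by rewrite -eO subsetUl.
    apply/qtopP=> x y xy; rewrite -eO => /setUP[xO|/imsetP[i iO ex]].
      by rewrite inE (oO _ _ xy).
    apply/setUP; case: (boolP (y \in O)) => yO; [by left|right].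
    have yC : y \in ~: O by rewrite inE.
    apply/imsetP; exists (enum_rank_in yC y); last by rewrite enum_rankK_in.
    by apply: o iO; rewrite qpullE enum_rankK_in -?ex.
  split; first by apply/qtopP=> i j; rewrite qpullE !inE; apply: o.
  apply/eqP/setP=> x; apply/setUP/idP=> [[/(subsetP sO)//|/imsetP[i]]|xO2].
    by rewrite inE => ? ->.
  case: (boolP (x \in O)) => xO; [by left|right].
  have xC : x \in ~: O by rewrite inE.
  apply/imsetP; exists (enum_rank_in xC x); last by rewrite enum_rankK_in.
  by rewrite inE enum_rankK_in.
move=> O2 _; apply/setP=> i; rewrite !inE mem_imset; last exact: enum_val_inj.
by have := enum_valP i; rewrite inE => /negbTE->.
Qed.

(** Both sides are the sum over the flags of open sets [O1] contained in [O2] of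
    the three successive differences. *)
Lemma big_flags (F : QP -> QP -> QP -> R) :
  \sum_(O in qtop P) \sum_(O' in qtop (tagged (QPstd P (~: O))))
    F (QPstd (tagged (QPstd P (~: O))) (~: O'))
      (QPstd (tagged (QPstd P (~: O))) O') (QPstd P O) =
  \sum_(O in qtop P) \sum_(O' in qtop (tagged (QPstd P O)))
    F (QPstd P (~: O)) (QPstd (tagged (QPstd P O)) (~: O'))
      (QPstd (tagged (QPstd P O)) O').
Proof.
under eq_bigr => O oO do rewrite (big_qtop_closed _ oO).
under [RHS]eq_bigr => O oO do rewrite (big_qtop_open _ oO).
rewrite (exchange_big_dep (mem (qtop P))) /=; last by move=> O O' _ /andP[].
apply: eq_bigr => O2 oO2; apply: eq_big => O; first by rewrite oO2.
case/andP=> _ /andP[_ sO]; rewrite -!preimsetC !QPstd_std.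
rewrite -setCU (setUidPr sO) (setIidPr sO); congr F; congr QPstd; exact: setIC.
Qed.

Lemma qtop_qquot (e : eqv 'I_n) (O : {set 'I_n}) :
  (O \in qtop (qquot P e)) = (O \in qtop P) &&
  separated (fun i : 'I_#|~: O| => enum_val i) (fun i : 'I_#|O| => enum_val i) e.
Proof.
apply/qtopP/andP=> [o|[/qtopP o s] x y].
  split; first by apply/qtopP=> x y xy; apply: o; apply: qquot_le.
  apply/forallP=> i; apply/forallP=> j; apply/negP=> eij.
  have := enum_valP i; rewrite inE => /negP; apply.
  by apply: (o (enum_val j)) (enum_valP j); apply: qquot_eqv; rewrite eqv_sym.
apply: qquot_stable => // {}x {}y xy xO; apply/negPn/negP=> yO.
have yC : y \in ~: O by rewrite inE.
have /negP := forallP (forallP s (enum_rank_in yC y)) (enum_rank_in xO x).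
by rewrite !enum_rankK_in // eqv_sym.
Qed.

Lemma enum_glue_bij (O : {set 'I_n}) :
  bijective (glue (fun i : 'I_#|~: O| => enum_val i) (fun i : 'I_#|O| => enum_val i)).
Proof.
apply: inj_card_bij; last by rewrite card_sum !card_ord addnC cardsC card_ord.
have no (i : 'I_#|~: O|) (j : 'I_#|O|) : enum_val i <> enum_val j.
  by move=> ij; have := enum_valP i; rewrite inE ij enum_valP.
case=> i [] j //= h.
- by rewrite (enum_val_inj h).
- by case: (no _ _ h).
- by case: (no _ _ (esym h)).
- by rewrite (enum_val_inj h).
Qed.
End Flags.

Lemma big_qtop_mul (R : nmodType) (P Q : QP) (F : QP -> QP -> R) :
  (\sum_(O in qtop (tagged (QPmul P Q)))
    F (QPstd (tagged (QPmul P Q)) (~: O)) (QPstd (tagged (QPmul P Q)) O) =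
  \sum_(O1 in qtop (tagged P)) \sum_(O2 in qtop (tagged Q))
    F (QPmul (QPstd (tagged P) (~: O1)) (QPstd (tagged Q) (~: O2)))
      (QPmul (QPstd (tagged P) O1) (QPstd (tagged Q) O2)))%R.
Proof.
under eq_bigr do rewrite !QPstd_mul.
rewrite pair_big /=.
pose pre (O : {set 'I_(tag P + tag Q)}) := ((@lshift _ _) @^-1: O, (@rshift _ _) @^-1: O).
pose im (O : {set 'I_(tag P)} * {set 'I_(tag Q)}) :=
  ((@lshift _ (tag Q)) @: O.1 :|: (@rshift (tag P) _) @: O.2).
have imK O : pre (im O) = O.
  case: O => O1 O2; congr pair; apply/setP=> x; rewrite !inE.
    rewrite mem_imset; last exact: lshift_inj.
    by apply/orP/idP=> [[//|/imsetP[y _] /eqP]|->]; [rewrite eq_lrshift | left].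
  rewrite orbC mem_imset; last exact: rshift_inj.
  by apply/orP/idP=> [[//|/imsetP[y _] /eqP]|->]; [rewrite eq_rlshift | left].
have preK O : im (pre O) = O.
  apply/setP; apply: (glueP (unsplit_bij _ _)) => x.
    by rewrite inE (mem_imset _ _ (@lshift_inj _ _)) inE;
      apply/orP/idP=> [[//|/imsetP[y _] /eqP]|->]; [rewrite eq_lrshift | left].
  by rewrite inE orbC (mem_imset _ _ (@rshift_inj _ _)) inE;
    apply/orP/idP=> [[//|/imsetP[y _] /eqP]|->]; [rewrite eq_rlshift | left].
rewrite (reindex im) /=; last by exists pre => O _.
apply: eq_big => [O|O _].
  have eO : O = pre (im O) by rewrite imK.
  rewrite {2 3}eO /=; move: (im O) => {eO} O'.
  apply/qtopP/andP=> [o|[/qtopP o1 /qtopP o2]].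
    split; apply/qtopP=> x y xy; rewrite !inE; apply: o.
      by rewrite QPmulEl.
    by rewrite QPmulEr.
  apply: (glueP (unsplit_bij _ _)) => x; apply: (glueP (unsplit_bij _ _)) => y.
  - by rewrite QPmulEl => xy; have := o1 _ _ xy; rewrite !inE.
  - by rewrite QPmulElr.
  - by rewrite QPmulErl.
  - by rewrite QPmulEr => xy; have := o2 _ _ xy; rewrite !inE.
have [-> ->] : (@lshift _ _) @^-1: im O = O.1 /\ (@rshift _ _) @^-1: im O = O.2.
  by rewrite -{2 4}(imK O).
have [-> ->] // : (@lshift _ _) @^-1: (~: im O) = ~: O.1 /\ (@rshift _ _) @^-1: (~: im O) = ~: O.2.
by rewrite !preimsetC -{2 4}(imK O).
Qed.

Local Open Scope ring_scope.

(** * Sums over admissible equivalences *)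

Section AdmissibleSums.
Variable R : nmodType.

(** Stated for an arbitrary summand, since it is used once with isoclasses on the
    left and once without. *)
Lemma big_nested (T : finType) (P : qorder T) (F : qorder T -> qorder T -> qorder T -> R) :
  \sum_(e | admissible P e) \sum_(f | admissible (qquot P e) f)
    F (qquot (qquot P e) f) (qcut (qquot P e) f) (qcut P e) =
  \sum_(f | admissible P f) \sum_(e | admissible (qcut P f) e)
    F (qquot P f) (qquot (qcut P f) e) (qcut (qcut P f) e).
Proof.
(* both sides are sums over pairs, with components in opposite orders *)
rewrite !pair_big_dep /= (reindex (fun p => (p.2, p.1))) /=; last first.
  by exists (fun p => (p.2, p.1)) => [] [].
apply: eq_big => [[e f]|[e f]] /=; first exact: admissible_nested.
rewrite admissible_nested => /andP[/admissibleP[_ sf] ef].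
have {}ef := admissible_cut_sub ef.
by rewrite qquot_qquot // qcut_qquot // qcut_qcut.
Qed.

Lemma isoclass_sum (P A B : QP) :
  qiso (tagged P) (qsum (tagged A) (tagged B)) ->
  isoclass P = qpmul (isoclass A) (isoclass B).
Proof.
move=> PAB; rewrite qpmulE; apply/isoclassP; apply: qiso_trans PAB _.
apply: qiso_sym_imp; apply: qiso_pull.
by exists (@unsplit _ _); [apply: splitK | apply: unsplitK].
Qed.

(** Neither block of a product is related to the other, so a zigzag never leaves
    its block. *)
Lemma separated_mul (P Q : QP) (e : eqv 'I_(tag P + tag Q)) :
  admissible (tagged (QPmul P Q)) e -> separated (@lshift _ _) (@rshift _ _) e.
Proof.
case/admissibleP=> c _; apply/forallP=> u; apply/forallP=> v; apply/negP=> /c.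
case/connectP=> p; elim: p u => [|z p IH] u /=.
  by move=> _ /eqP; rewrite eq_rlshift.
case/andP=> /andP[_]; move: z; apply: (glueP (unsplit_bij _ _)) => z.
  by move=> _; apply: IH.
by rewrite QPmulElr QPmulErl.
Qed.

(** The quotients agree on the nose, as required in the left factor of the
    coaction, while the cuts are only compared up to isomorphism. *)
Lemma big_admissible_mul (P Q : QP) (F : QP -> qp -> R) :
  \sum_(e : eqv 'I_(tag (QPmul P Q)) | admissible (tagged (QPmul P Q)) e)
    F (QPquot e) (isoclass (QPcut e)) =
  \sum_(e1 : eqv 'I_(tag P) | admissible (tagged P) e1)
    \sum_(e2 : eqv 'I_(tag Q) | admissible (tagged Q) e2)
      F (QPmul (QPquot e1) (QPquot e2))
        (qpmul (isoclass (QPcut e1)) (isoclass (QPcut e2))).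
Proof.
have [pl pr] := QPmul_pull P Q.
have b := unsplit_bij (tag P) (tag Q).
have dn u v : tagged (QPmul P Q) (rshift (tag P) v) (lshift (tag Q) u) = false.
  exact: QPmulErl.
have := big_glue b (F := fun e => F (@QPquot (QPmul P Q) e) (isoclass (@QPcut (QPmul P Q) e)))
  (G := fun e1 e2 => F (QPmul (@QPquot P e1) (@QPquot Q e2))
     (qpmul (isoclass (@QPcut P e1)) (isoclass (@QPcut Q e2)))) dn.
rewrite pl pr => <-.
  by apply: eq_bigl => e; rewrite andb_idr //; apply: separated_mul.
move=> e se _; congr F; last first.
  apply: isoclass_sum; apply: qiso_trans (qcut_glue b _ se) _.
  by rewrite pl pr; apply: qiso_refl.
congr mkQP; apply/qorderP; apply: (glueP b) => x; apply: (glueP b) => y.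
- by rewrite (qquot_glue_inl b) // pl; apply/esym/(@QPmulEl (@QPquot P _) (@QPquot Q _)).
- rewrite [RHS](@QPmulElr (@QPquot P _) (@QPquot Q _)); apply/negP=> h.
  (* no path leads from the first block to the second *)
  have : rshift (tag P) y \in codom (@lshift (tag P) (tag Q)).
    apply: (qquot_stable _ _ h); last exact: codom_f.
      move=> a c ac /codomP[w aw]; move: ac; rewrite {}aw; move: c.
      by apply: (glueP b) => d; rewrite ?QPmulElr ?codom_f.
    move=> a c ac /codomP[w aw]; move: ac; rewrite {}aw; move: c.
    by apply: (glueP b) => d; rewrite ?codom_f // (separatedP se).
  by case/codomP=> w /eqP; rewrite eq_rlshift.
- by rewrite (qquot_glue_down b) //; apply/esym/(@QPmulErl (@QPquot P _) (@QPquot Q _)).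
- by rewrite (qquot_glue_inr b) // pr; apply/esym/(@QPmulEr (@QPquot P _) (@QPquot Q _)).
Qed.

(** After exchanging the sums, the equivalences left for a given open set [O] are
    the admissible ones that do not mix [O] and its complement. *)
Lemma big_admissible_comul (P : QP) (F : QP -> QP -> qp -> R) :
  \sum_(e : eqv 'I_(tag P) | admissible (tagged P) e)
    \sum_(O in qtop (tagged (QPquot e)))
      F (QPstd (tagged (QPquot e)) (~: O)) (QPstd (tagged (QPquot e)) O) (isoclass (QPcut e)) =
  \sum_(O in qtop (tagged P))
    \sum_(e1 | admissible (tagged (QPstd (tagged P) (~: O))) e1)
      \sum_(e2 | admissible (tagged (QPstd (tagged P) O)) e2)
        F (QPquot e1) (QPquot e2) (qpmul (isoclass (QPcut e1)) (isoclass (QPcut e2))).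
Proof.
rewrite /QPquot /= (exchange_big_dep (mem (qtop (tagged P)))) /=; last first.
  by move=> e O _; rewrite qtop_qquot => /andP[].
apply: eq_bigr => O oO; have b := enum_glue_bij O.
rewrite -(big_glue b (F := fun e => F (QPstd (qquot (tagged P) e) (~: O))
  (QPstd (qquot (tagged P) e) O) (isoclass (QPcut e)))).
- by apply: eq_bigl => e; rewrite qtop_qquot oO.
- move=> u v; apply/negP=> h; have := enum_valP u.
  by rewrite inE (qtopP _ _ oO _ _ h) // enum_valP.
move=> e se _.
have dn (u : 'I_#|~: O|) (v : 'I_#|O|) : tagged P (enum_val v) (enum_val u) = false.
  by apply/negP=> h; have := enum_valP u; rewrite inE (qtopP _ _ oO _ _ h) // enum_valP.
congr F.
- congr mkQP; apply/qorderP=> x y; rewrite qpullE.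
  exact: (qquot_glue_inl b dn se).
- congr mkQP; apply/qorderP=> x y; rewrite qpullE.
  exact: (qquot_glue_inr b dn se).
by apply: isoclass_sum; exact: (qcut_glue b (tagged P) se).
Qed.

(** The empty set carries exactly one equivalence, and it is admissible. *)
Lemma big_admissible_one (F : QP -> QP -> R) :
  \sum_(e : eqv 'I_(tag QPone) | admissible (tagged QPone) e) F (QPquot e) (QPcut e) =
  F QPone QPone.
Proof.
rewrite (eq_bigl (pred1 (sim_eqv (tagged QPone)))) => [|e].
  by rewrite big_pred1_eq; congr F; apply: QP_size0.
have -> : e = sim_eqv (tagged QPone) by apply: eqvP => -[].
rewrite /= eqxx; apply/admissibleP; split; by case.
Qed.
End AdmissibleSums.

(** * Linear extension *)

Section LinearTools.
Variable K : fieldType.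

HB.instance Definition _ (X X' Y Y' : choiceType)
    (f : {malg K[X]} -> {malg K[X']}) (g : {malg K[Y]} -> {malg K[Y']}) :=
  GRing.Linear.on (tmap f g).
HB.instance Definition _ (X Y : choiceType) (f : {malg K[X]} -> K) :=
  GRing.Linear.on (@tcontrl K X Y f).
HB.instance Definition _ (X Y : choiceType) (f : {malg K[Y]} -> K) :=
  GRing.Linear.on (@tcontrr K X Y f).
HB.instance Definition _ (X Y Z : choiceType) := GRing.Linear.on (@tassoc K X Y Z).
HB.instance Definition _ (M N : monomType) := GRing.Linear.on (@m324 K M N).

Lemma malg1E (M : monomType) : 1 = << mone >> :> {malg K[M]}.
Proof. by []. Qed.

Lemma tens11 (M N : monomType) : tens 1 1 = 1 :> {malg K[(M * N)%type]}.
Proof. by rewrite !malg1E tensU. Qed.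

Lemma tens_suml (X Y : choiceType) (I : finType) (p : pred I) (F : I -> {malg K[X]})
    (v : {malg K[Y]}) : tens (\sum_(i | p i) F i) v = \sum_(i | p i) tens (F i) v.
Proof. exact: linear_sum. Qed.

Lemma tens_sumr (X Y : choiceType) (I : finType) (p : pred I) (u : {malg K[X]})
    (F : I -> {malg K[Y]}) : tens u (\sum_(i | p i) F i) = \sum_(i | p i) tens u (F i).
Proof.
apply: (big_morph (tens u)) => [x y|]; last exact: tens0r.
by have := tens_linr 1 u x y; rewrite !scale1r.
Qed.

Lemma sum_nat_scale (V : lmodType K) (I : finType) (p b : pred I) (F : I -> V) :
  \sum_(i | p i) (b i)%:R *: F i = \sum_(i | p i && b i) F i.
Proof.
rewrite big_mkcondr; apply: eq_bigr => i _.
by case: (b i); rewrite ?scale1r ?scale0r.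
Qed.

Lemma tmap_sum (X X' Y Y' : choiceType) (f : {malg K[X]} -> {malg K[X']})
    (g : {malg K[Y]} -> {malg K[Y']}) (I : finType) (p : pred I) F :
  tmap f g (\sum_(i | p i) F i) = \sum_(i | p i) tmap f g (F i).
Proof. exact: linear_sum. Qed.

Lemma tcontrl_sum (X Y : choiceType) (f : {malg K[X]} -> K) (I : finType) (p : pred I)
    (F : I -> {malg K[(X * Y)%type]}) :
  tcontrl f (\sum_(i | p i) F i) = \sum_(i | p i) tcontrl f (F i).
Proof. exact: linear_sum. Qed.

Lemma tcontrr_sum (X Y : choiceType) (f : {malg K[Y]} -> K) (I : finType) (p : pred I)
    (F : I -> {malg K[(X * Y)%type]}) :
  tcontrr f (\sum_(i | p i) F i) = \sum_(i | p i) tcontrr f (F i).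
Proof. exact: linear_sum. Qed.

Lemma tassoc_sum (X Y Z : choiceType) (I : finType) (p : pred I)
    (F : I -> {malg K[((X * Y) * Z)%type]}) :
  tassoc (\sum_(i | p i) F i) = \sum_(i | p i) tassoc (F i).
Proof. exact: linear_sum. Qed.

Lemma m324_sum (M N : monomType) (I : finType) (p : pred I)
    (F : I -> {malg K[((M * N) * (M * N))%type]}) :
  m324 (\sum_(i | p i) F i) = \sum_(i | p i) m324 (F i).
Proof. exact: linear_sum. Qed.

Lemma tmapU (X X' Y Y' : choiceType) (f : {malg K[X]} -> {malg K[X']})
    (g : {malg K[Y]} -> {malg K[Y']}) x y :
  tmap f g << (x, y) >> = tens (f << x >>) (g << y >>).
Proof. exact: linextU. Qed.

Lemma tcontrlU (X Y : choiceType) (f : {malg K[X]} -> K) (x : X) (y : Y) :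
  tcontrl f << (x, y) >> = f << x >> *: << y >>.
Proof. exact: linextU. Qed.

Lemma tcontrrU (X Y : choiceType) (f : {malg K[Y]} -> K) (x : X) (y : Y) :
  tcontrr f << (x, y) >> = f << y >> *: << x >>.
Proof. exact: linextU. Qed.

Lemma tassocU (X Y Z : choiceType) (x : X) (y : Y) (z : Z) :
  tassoc << ((x, y), z) >> = << (x, (y, z)) >> :> {malg K[_]}.
Proof. exact: linextU. Qed.

Lemma m324U (M N : monomType) (a b : M) (x y : N) :
  m324 << ((a, x), (b, y)) >> = << ((a, b), mmul x y) >> :> {malg K[_]}.
Proof. by rewrite /m324 linextU /= malgUM !tensU. Qed.

Lemma linear_ext (X : choiceType) (V : lmodType K) (f g : {linear {malg K[X]} -> V}) :
  (forall x, f << x >> = g << x >>) -> f =1 g.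
Proof.
move=> fg a; elim/malg_linind: a => [|//|k u v hu hv]; first by rewrite !linear0.
by rewrite !linearP hu hv.
Qed.

(** In a left algebra scalars need not commute with the left factor of a product,
    hence the first hypothesis. *)
Lemma linear_mul (M : monomType) (A : lalgType K) (f : {linear {malg K[M]} -> A}) :
  (forall a (u v : A), u * (a *: v) = a *: (u * v)) ->
  (forall x y, f << mmul x y >> = f << x >> * f << y >>) ->
  forall a b, f (a * b) = f a * f b.
Proof.
move=> Ar fM a b; elim/malg_linind: a => [|x|k u v hu hv].
- by rewrite mul0r !linear0 mul0r.
- elim/malg_linind: b => [|y|k u v hu hv].
  + by rewrite mulr0 !linear0 mulr0.
  + by rewrite malgUM.
  by rewrite mulrDr malg_scalerAr !linearP hu hv mulrDr Ar.
by rewrite mulrDl -scalerAl !linearP hu hv mulrDl -scalerAl.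
Qed.
End LinearTools.

(** * The bialgebra of quasi-posets *)

Section Bialgebras.
Variable K : fieldType.

Lemma comul_QPU P : @comul_QP K << P >> = \sum_(O in qtop (tagged P))
  << (QPstd (tagged P) (~: O), QPstd (tagged P) O) >>.
Proof. exact: linextU. Qed.

Lemma counit_QPU P : @counit_QP K << P >> = (P == QPone)%:R.
Proof. exact: linextU. Qed.

Lemma rho_QPU P : @rho_QP K << P >> =
  \sum_(e : eqv 'I_(tag P) | admissible (tagged P) e) << (QPquot e, isoclass (QPcut e)) >>.
Proof. exact: linextU. Qed.

Lemma comul_QP_coassoc (a : {malg K[QP]}) :
  tassoc (tmap (@comul_QP K) id (comul_QP a)) = tmap id (@comul_QP K) (comul_QP a).
Proof.
move: a; apply: (linear_ext
  (f := @tassoc K _ _ _ \o tmap (@comul_QP K) id \o @comul_QP K)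
  (g := tmap id (@comul_QP K) \o @comul_QP K)) => P /=.
rewrite comul_QPU !tmap_sum tassoc_sum.
have sumE := big_flags (tagged P) (fun A B C => << (A, (B, C)) >> : {malg K[_]}).
apply: etrans _ (etrans sumE _).
  apply: eq_bigr => O _; rewrite tmapU comul_QPU tens_suml tassoc_sum.
  by apply: eq_bigr => O' _; rewrite tensU tassocU.
apply: eq_bigr => O _; rewrite tmapU comul_QPU tens_sumr.
by apply: eq_bigr => O' _; rewrite tensU.
Qed.

Lemma comul_QP_counitl (a : {malg K[QP]}) : tcontrl (@counit_QP K) (comul_QP a) = a.
Proof.
move: a; apply: (linear_ext
  (f := tcontrl (@counit_QP K) \o @comul_QP K)
  (g := idfun)) => P /=.
rewrite comul_QPU tcontrl_sum.
under eq_bigr => O _ do rewrite tcontrlU counit_QPU QPstd_eq1.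
rewrite sum_nat_scale (big_pred1 setT) => [|O]; first by rewrite QPstdT; case: P.
rewrite -setCT (inj_eq (@setC_inj _)); apply/andP/eqP=> [[_ /eqP]//|->].
by rewrite setT_top.
Qed.

Lemma comul_QP_counitr (a : {malg K[QP]}) : tcontrr (@counit_QP K) (comul_QP a) = a.
Proof.
move: a; apply: (linear_ext
  (f := tcontrr (@counit_QP K) \o @comul_QP K)
  (g := idfun)) => P /=.
rewrite comul_QPU tcontrr_sum.
under eq_bigr => O _ do rewrite tcontrrU counit_QPU QPstd_eq1.
rewrite sum_nat_scale (big_pred1 set0) => [|O]; first by rewrite setC0 QPstdT; case: P.
by apply/andP/eqP=> [[_ /eqP]//|->]; rewrite set0_top.
Qed.

Lemma comul_QP1 : comul_QP (1 : {malg K[QP]}) = tens 1 1.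
Proof.
rewrite tens11 !malg1E comul_QPU (big_pred1 set0) => [|O].
  by congr << (_, _) >>; apply: QP_size0; apply/eqP;
    rewrite -leqn0 -[X in (_ <= X)%N](card_ord 0) max_card.
by rewrite /= (_ : O = set0) ?set0_top ?eqxx //; apply/setP=> -[].
Qed.

Lemma comul_QPM (a b : {malg K[QP]}) : comul_QP (a * b) = comul_QP a * comul_QP b.
Proof.
apply: linear_mul => [k u v|P Q]; first exact: malg_scalerAr.
rewrite /= 3!comul_QPU (big_qtop_mul P Q (fun A B => << (A, B) >>)) mulr_suml.
by apply: eq_bigr => O _; rewrite mulr_sumr; apply: eq_bigr => O' _; rewrite malgUM.
Qed.

Lemma counit_QP1 : counit_QP (1 : {malg K[QP]}) = 1 :> K.
Proof. by rewrite malg1E counit_QPU eqxx. Qed.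

Lemma counit_QPM (a b : {malg K[QP]}) :
  counit_QP (a * b) = (counit_QP a : K) * (counit_QP b : K).
Proof.
apply: (@linear_mul K QP K^o) => [k u v|P Q]; first exact: mulrCA.
rewrite /= 3!counit_QPU -[RHS]/((_ : K) * _) -natrM mulnb; congr (nat_of_bool _)%:R.
by apply/eqP/andP=> [/QPunit[-> ->] //|[/eqP-> /eqP->]]; apply: QP1mul.
Qed.

Lemma HQP_bialgebra : is_bialgebra (HQP K).
Proof.
split; [exact: comul_QP_coassoc|exact: comul_QP_counitl|exact: comul_QP_counitr|
  exact: comul_QP1|exact: comul_QPM|exact: counit_QP1|exact: counit_QPM].
Qed.

(** * The bialgebra of isoclasses *)

Lemma comul_qp_coassoc (a : {malg K[qp]}) :
  tassoc (tmap (@comul_qp K) id (comul_qp a)) = tmap id (@comul_qp K) (comul_qp a).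
Proof.
move: a; apply: (linear_ext
  (f := @tassoc K _ _ _ \o tmap (@comul_qp K) id \o @comul_qp K)
  (g := tmap id (@comul_qp K) \o @comul_qp K)) => p /=.
rewrite -(isoclass_repr p); move: (repr p) => {p} P.
rewrite comul_qpE /delta_of !tmap_sum tassoc_sum.
have sumE := big_nested (tagged P) (fun A B C =>
  << (isoclass (mkQP A), (isoclass (mkQP B), isoclass (mkQP C))) >> : {malg K[_]}).
apply: etrans _ (etrans sumE _).
  apply: eq_bigr => e _; rewrite tmapU comul_qpE tens_suml tassoc_sum.
  by apply: eq_bigr => f _; rewrite tensU tassocU.
apply: eq_bigr => f _; rewrite tmapU comul_qpE tens_sumr.
by apply: eq_bigr => e _; rewrite tensU.
Qed.

Lemma comul_qp_counitl (a : {malg K[qp]}) : tcontrl (@counit_qp K) (comul_qp a) = a.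
Proof.
move: a; apply: (linear_ext
  (f := tcontrl (@counit_qp K) \o @comul_qp K)
  (g := idfun)) => p /=.
rewrite -(isoclass_repr p); move: (repr p) => {p} P.
rewrite comul_qpE /delta_of tcontrl_sum.
under eq_bigr => e _ do rewrite tcontrlU counit_qpE.
rewrite sum_nat_scale (big_pred1 (comp_eqv (tagged P))) => [|e].
  by rewrite /QPcut qcut_comp; case: (P).
exact: admissible_discrete_quot.
Qed.

Lemma comul_qp_counitr (a : {malg K[qp]}) : tcontrr (@counit_qp K) (comul_qp a) = a.
Proof.
move: a; apply: (linear_ext
  (f := tcontrr (@counit_qp K) \o @comul_qp K)
  (g := idfun)) => p /=.
rewrite -(isoclass_repr p); move: (repr p) => {p} P.
rewrite comul_qpE /delta_of tcontrr_sum.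
under eq_bigr => e _ do rewrite tcontrrU counit_qpE.
rewrite sum_nat_scale (big_pred1 (sim_eqv (tagged P))) => [|e].
  by rewrite /QPquot qquot_sim; case: (P).
exact: admissible_discrete_cut.
Qed.

Lemma comul_qp1 : comul_qp (1 : {malg K[qp]}) = tens 1 1.
Proof.
rewrite tens11 !malg1E comul_qpE.
exact: (big_admissible_one (fun A B => << (isoclass A, isoclass B) >>)).
Qed.

Lemma comul_qpM (a b : {malg K[qp]}) : comul_qp (a * b) = comul_qp a * comul_qp b.
Proof.
apply: linear_mul => [k u v|p q]; first exact: malg_scalerAr.
rewrite -(isoclass_repr p) -(isoclass_repr q); move: (repr p) (repr q) => {p q} P Q.
rewrite /= [mmul _ _]qpmulE 3!comul_qpE.
rewrite [LHS](@big_admissible_mul _ P Q (fun A B => << (isoclass A, B) >>)) mulr_suml.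
apply: eq_bigr => e _; rewrite mulr_sumr; apply: eq_bigr => f _.
by rewrite malgUM -qpmulE.
Qed.

Lemma counit_qp1 : counit_qp (1 : {malg K[qp]}) = 1 :> K.
Proof.
by rewrite malg1E counit_qpE (_ : qdiscrete _) //; apply/forallP=> -[].
Qed.

Lemma counit_qpM (a b : {malg K[qp]}) :
  counit_qp (a * b) = (counit_qp a : K) * (counit_qp b : K).
Proof.
apply: (@linear_mul K qp K^o) => [k u v|p q]; first exact: mulrCA.
rewrite -(isoclass_repr p) -(isoclass_repr q); move: (repr p) (repr q) => {p q} P Q.
rewrite /= [mmul _ _]qpmulE 3!counit_qpE -[RHS]/((_ : K) * _) -natrM mulnb.
congr (nat_of_bool _)%:R; apply/qdiscreteP/andP=> [s|[/qdiscreteP sP /qdiscreteP sQ]].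
  split; apply/qdiscreteP=> x y.
    by have := s (lshift _ x) (lshift _ y); rewrite !QPmulEl.
  by have := s (rshift _ x) (rshift _ y); rewrite !QPmulEr.
apply: (glueP (unsplit_bij _ _)) => x; apply: (glueP (unsplit_bij _ _)) => y.
- by rewrite !QPmulEl.
- by rewrite QPmulElr QPmulErl.
- by rewrite QPmulElr QPmulErl.
- by rewrite !QPmulEr.
Qed.

Lemma Hqp_bialgebra : is_bialgebra (Hqp K).
Proof.
split; [exact: comul_qp_coassoc|exact: comul_qp_counitl|exact: comul_qp_counitr|
  exact: comul_qp1|exact: comul_qpM|exact: counit_qp1|exact: counit_qpM].
Qed.

(** * The coaction *)

Lemma rho_QP_coassoc (a : {malg K[QP]}) :
  tassoc (tmap (@rho_QP K) id (rho_QP a)) = tmap id (@comul_qp K) (rho_QP a).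
Proof.
move: a; apply: (linear_ext
  (f := @tassoc K _ _ _ \o tmap (@rho_QP K) id \o @rho_QP K)
  (g := tmap id (@comul_qp K) \o @rho_QP K)) => P /=.
rewrite rho_QPU !tmap_sum tassoc_sum.
have sumE := big_nested (tagged P) (fun A B C =>
  << (mkQP A, (isoclass (mkQP B), isoclass (mkQP C))) >> : {malg K[_]}).
apply: etrans _ (etrans sumE _).
  apply: eq_bigr => e _; rewrite tmapU rho_QPU tens_suml tassoc_sum.
  by apply: eq_bigr => f _; rewrite tensU tassocU.
apply: eq_bigr => f _; rewrite tmapU comul_qpE tens_sumr.
by apply: eq_bigr => e _; rewrite tensU.
Qed.

Lemma rho_QP_counit (a : {malg K[QP]}) : tcontrr (@counit_qp K) (rho_QP a) = a.
Proof.
move: a; apply: (linear_ext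
  (f := tcontrr (@counit_qp K) \o @rho_QP K)
  (g := idfun)) => P /=.
rewrite rho_QPU tcontrr_sum.
under eq_bigr => e _ do rewrite tcontrrU counit_qpE.
rewrite sum_nat_scale (big_pred1 (sim_eqv (tagged P))) => [|e].
  by rewrite /QPquot qquot_sim; case: (P).
exact: admissible_discrete_cut.
Qed.

Lemma rho_QP1 : rho_QP (1 : {malg K[QP]}) = tens 1 1.
Proof.
rewrite tens11 !malg1E rho_QPU.
exact: (big_admissible_one (fun A B => << (A, isoclass B) >>)).
Qed.

Lemma rho_QPM (a b : {malg K[QP]}) : rho_QP (a * b) = rho_QP a * rho_QP b.
Proof.
apply: linear_mul => [k u v|P Q]; first exact: malg_scalerAr.
rewrite /= 3!rho_QPU.
rewrite [LHS](@big_admissible_mul _ P Q (fun A B => << (A, B) >>)) mulr_suml.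
apply: eq_bigr => e _; rewrite mulr_sumr; apply: eq_bigr => f _.
by rewrite malgUM.
Qed.

Lemma rho_QP_comul (a : {malg K[QP]}) :
  m324 (tmap (@rho_QP K) (@rho_QP K) (comul_QP a)) = tmap (@comul_QP K) id (rho_QP a).
Proof.
move: a; apply: (linear_ext
  (f := @m324 K _ _ \o tmap (@rho_QP K) (@rho_QP K) \o @comul_QP K)
  (g := tmap (@comul_QP K) id \o @rho_QP K)) => P /=.
rewrite rho_QPU comul_QPU !tmap_sum m324_sum.
have sumE := big_admissible_comul P (fun A B c => << ((A, B), c) >> : {malg K[_]}).
apply: etrans _ (etrans (esym sumE) _).
  apply: eq_bigr => O _; rewrite tmapU !rho_QPU tens_suml m324_sum.
  apply: eq_bigr => e _; rewrite tens_sumr m324_sum; apply: eq_bigr => f _.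
  by rewrite tensU m324U.
apply: eq_bigr => e _; rewrite tmapU comul_QPU tens_suml.
by apply: eq_bigr => O _; rewrite tensU.
Qed.

(** A quotient has the same ground set, hence is empty only for the empty
    quasi-poset. *)
Lemma rho_QP_counit_QP (a : {malg K[QP]}) :
  tcontrl (@counit_QP K) (rho_QP a) = (counit_QP a : K) *: 1.
Proof.
elim/malg_linind: a => [|P|k u v hu hv].
- by rewrite !linear0 scale0r.
- have [->|P0] := eqVneq P QPone.
    have := rho_QP1; rewrite tens11 !malg1E => ->.
    by rewrite tcontrlU.
  rewrite rho_QPU tcontrl_sum big1 => [|e _] /=.
    by rewrite counit_QPU (negbTE P0) scale0r.
  rewrite tcontrlU counit_QPU (_ : _ == _ = false) ?scale0r //.
  by apply: contraNF P0 => /eqP/(congr1 tag) /= /QP_size0->.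
by rewrite !linearP /= hu hv scalerDl scalerA.
Qed.
End Bialgebras.

Theorem theorem18 (K : fieldType) (charK : [pchar K]%R =i pred0) :
  cointeraction (HQP K) (Hqp K) (@rho_QP K).
Proof.
split.
- exact: HQP_bialgebra.
- exact: Hqp_bialgebra.
- by split; [exact: rho_QP_coassoc | exact: rho_QP_counit].
- exact: rho_QP1.
- exact: rho_QP_comul.
- exact: rho_QPM.
- exact: rho_QP_counit_QP.
Qed.
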